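(* Consider the subcritical branching random walk described in the context, with offspring distribution $(p_k)_{k\ge 0}$ of mean $m\in(0,1)$ having a finite third moment, and jump distribution $(a_y)_{y\in\mathbb{Z}}$ with mean zero, finite variance, $a_0<1$, and $K(\theta)<\infty$ for all $\theta\ge 1$. For $c\ge0$ and $n\in\mathbb{N}$ define $g(c,n)=\rho(m^{-1})^{cn}\,P(M_n\ge cn)$. Then there exist $0<\underline{\delta}\le\overline{\delta}<\infty$ such that: (a) For every $c\in(0,\underline{\delta})$, $0<\liminf_{n\to\infty}g(c,n)\le\limsup_{n\to\infty}g(c,n)\le1$. (b) Moreover, if $W$ has a finite right range $R$ and is nearly right-continuous, then $$\lim_{n\to\infty}g(c,n)=\kappa\quad\text{for all } c\in(0,\underline{\delta}),$$ where $\kappa\in(0,1]$ is the constant $\kappa=\lim_{n\to\infty}\rho(m^{-1})^nP(M\ge n)$ (this limit exists under the assumptions of (b)). (c) For every $c>\overline{\delta}$, $\lim_{n\to\infty}g(c,n)=0$. Moreover, if $W$ has a finite right range $R$, then $\overline{\delta}<R$.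
   Context: Branching random walk: $(a_y)_{y\in\mathbb{Z}}$ is the jump distribution and $(p_k)_{k\ge0}$ the offspring distribution. The process starts from a single particle (the root) at position $0$. In each generation particles first jump and then reproduce: each particle $v$ at position $X(v)$, independently of all others, makes a jump $\xi_v$ with $P(\xi_v=y)=a_y$ and then produces $N_v$ children, where $P(N_v=k)=p_k$ and $N_v$ is independent of $\xi_v$; all children of $v$ have position $X(v)+\xi_v$ (if $N_v=0$, the jump leaves no trace). $\mathcal{T}$ is the genealogical Galton–Watson tree, $|v|$ is the generation of $v$ (the root has generation $0$), and $X(v)$ its position. Set $M_n=\max_{v\in\mathcal{T},|v|\le n}X(v)$ and $M=\sup_{n\ge0}M_n$. Random walk: $W=(W_n)_{n\ge0}$ is the random walk on $\mathbb{Z}$ with $W_0=0$ and i.i.d. increments with law $(a_y)$. $K(\theta)=E(\theta^{W_1})$ for $\theta\ge1$; under the assumptions $K(1)=1$ and $K$ is strictly increasing to $\infty$ on $[1,\infty)$, and for $\gamma>1$, $\rho(\gamma)$ denotes the unique $s\in(1,\infty)$ with $K(s)=\gamma$. $W$ has a finite right range $R>0$ if $a_R>0$ and $a_k=0$ for all $k>R$; in that case $W$ is nearly right-continuous if $a_i>0$ for all $i=1,\dots,R$.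
   Formalization: In (b), cn is replaced, in both the exponent and the event, by any integer k_n with |k_n − cn| < 1 (e.g. its floor or ceiling), since M_n is integer-valued and the limit with real cn fails for non-integer c. *)

(* Defs.v *)
From HB Require Import structures.
From mathcomp Require Export all_boot all_order all_algebra.
From mathcomp Require Export all_classical all_reals all_analysis.

Set Implicit Arguments.
Unset Strict Implicit.
Unset Printing Implicit Defensive.

Import Order.TTheory GRing.Theory Num.Theory.
Import numFieldNormedType.Exports.

Local Open Scope classical_set_scope.
Local Open Scope ring_scope.
Local Open Scope ereal_scope.

Section discrete_laws.
Context {R : realType} {I : choiceType}.
Implicit Types (q f : I -> R).

Definition is_pmf q : Prop :=
  (forall i, (0 <= q i)%R) /\ \esum_(i in [set: I]) (q i)%:E = 1.

(* The expectation of f under the law q, as positive part minus negative part;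
   since +oo - +oo = -oo in \bar R, a finite value means that f is
   q-integrable. *)
Definition dexpect q f : \bar R :=
  \esum_(i in [set: I]) (Num.max (f i) 0 * q i)%:E -
  \esum_(i in [set: I]) (Num.max (- f i) 0 * q i)%:E.

Definition dvariance q f : \bar R :=
  dexpect q (fun i => ((f i - fine (dexpect q f)) ^+ 2)%R).

End discrete_laws.

Section jump_law.
Context {R : realType}.
Implicit Types (a : int -> R).

Definition K a (theta : R) : \bar R := dexpect a (fun y => (theta ^ y)%R).

Definition rho a (gamma : R) : R :=
  xget 0%R [set s : R | (1 < s)%R /\ K a s = gamma%:E].

Definition finite_right_range a (r : nat) : Prop :=
  [/\ (0 < r)%N, (0 < a r%:Z)%R & forall k : int, (r%:Z < k)%R -> a k = 0%R].

Definition nearly_right_continuous a (r : nat) : Prop :=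
  forall i : nat, (0 < i <= r)%N -> (0 < a i%:Z)%R.

End jump_law.

(* Particles carry Ulam-Harris labels: the root is [::] and the children of v
   are rcons v 0, rcons v 1, ...  A jump xi v and an offspring number N v are
   attached to every label; those of labels outside the tree are never used. *)
Definition label : Type := seq nat.

Section branching_random_walk.
Context {d : measure_display} {T : measurableType d} {R : realType}.
Context (P : probability T R) (xi : label -> T -> int) (N : label -> T -> nat).

Record is_brw (a : int -> R) (p : nat -> R) : Prop := IsBRW {
  brw_jump_measurable : forall v y, measurable (xi v @^-1` [set y]);
  brw_offspring_measurable : forall v k, measurable (N v @^-1` [set k]);
  brw_jump_law : forall v y, P (xi v @^-1` [set y]) = (a y)%:E;
  brw_offspring_law : forall v k, P (N v @^-1` [set k]) = (p k)%:E;
  (* mutual independence of all the xi v and N v together; arbitrary sets A v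
     and B v are events since int and nat are countable, and a factor is left
     out by taking the full set *)
  brw_independent : forall (s : seq label) (A : label -> set int)
      (B : label -> set nat), uniq s ->
    P (\bigcap_(v in [set` s]) (xi v @^-1` A v `&` N v @^-1` B v)) =
    (\prod_(v <- s) (fine (P (xi v @^-1` A v)) * fine (P (N v @^-1` B v))))%:E
}.

(* v is a particle of the tree iff, for every i < |v|, its ancestor take i v of
   generation i has more than nth 0 v i children. *)
Definition tree (w : T) : set label :=
  [set v | forall i, (i < size v)%N -> (nth 0 v i < N (take i v) w)%N].

Definition position (v : label) (w : T) : int :=
  (\sum_(0 <= i < size v) xi (take i v) w)%R.

Definition maxpos_upto (n : nat) (w : T) : \bar R :=
  ereal_sup [set ((position v w)%:~R)%:E | v in
    [set v | tree w v /\ (size v <= n)%N]].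

Definition maxpos (w : T) : \bar R :=
  ereal_sup (range (fun n => maxpos_upto n w)).

(* rescaled_tail r x n = r ^ x * P (M_n >= x) *)
Definition rescaled_tail (r x : R) (n : nat) : \bar R :=
  (r `^ x)%:E * P [set w | x%:E <= maxpos_upto n w].

End branching_random_walk.

(* Main.v *)
(** Conditioning on the root, [h_n x = P (M_n >= x)] satisfies [h_0 = 1_(x <= 0)]
    and [h_{n+1} x = E (q (h_n (x - W_1)))] for [x > 0], where
    [q u = 1 - E ((1 - u) ^ N)] lies between [m u - E (N ^ 2) u ^ 2] and [m u] and
    is [m]-Lipschitz.  Everything then follows from comparison with exponentials:
    - [mu ^ n * s ^ -x] is a supersolution as soon as [m K(s) <= mu] and
      [1 <= mu]; [s = rho] gives the upper bound in (a), and a well-chosen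
      [s > rho] gives (c), because [m K(s) < (s / rho) ^ R] for large [s] when the
      right range is [R].
    - [min 1 (e * (rho ^ -x + rho ^ -2x))] is a stationary subsolution for small
      [e]: since [m K(rho ^ 2) > 1], the second term absorbs the quadratic loss.
    - A stationary subsolution below [t ^ -x], with [1 < t < rho], exceeds [h_n]
      by at most [(m K(t)) ^ n * t ^ -x], which for [x <= c n] and [c] small is
      negligible against [rho ^ -x].  This applies to the subsolution above (lower
      bound in (a)) and to [P (M >= x)] itself, which reduces (b) to the
      convergence of [phi x = rho ^ x * P (M >= x)].
    - [phi] is subharmonic for the [rho]-tilted walk, which crosses every block of
      [R] consecutive sites.  If [phi j] stays away from the limsup, then
      near right-continuity pushes [phi (j+1), ..., phi (j+R)], and hence all later
      values, strictly below the limsup; so [phi] converges. *)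

Require Import Defs.
From mathcomp Require Import lra ring zify.
Import Order.TTheory GRing.Theory Num.Theory.
Import numFieldNormedType.Exports.
Local Open Scope classical_set_scope.
Local Open Scope ring_scope.

Set Implicit Arguments.
Unset Strict Implicit.
Unset Printing Implicit Defensive.

(** * Means under a discrete law *)

Section mean.
Context {R : realType} {I : choiceType}.
Implicit Types (w g : I -> R).

(** Means are taken of nonnegative functions only. As [fine] sends an infinite sum to 0, the value
    is meaningful only together with [has_mean]. *)
Definition mean w g : R := fine (\esum_(i in [set: I]) (g i * w i)%:E).

Definition has_mean w g : Prop :=
  (forall i, 0 <= g i) /\ (\esum_(i in [set: I]) (g i * w i)%:E < +oo)%E.

Variable w : I -> R.
Hypothesis w_pmf : is_pmf w.

Let w_ge0 i : 0 <= w i. Proof. by case: w_pmf => + _; exact. Qed.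

Let term_ge0 g : (forall i, 0 <= g i) -> forall i, (0 <= (g i * w i)%:E)%E.
Proof. by move=> g0 i; rewrite lee_fin mulr_ge0. Qed.

Lemma meanE g : has_mean w g ->
  \esum_(i in [set: I]) (g i * w i)%:E = (mean w g)%:E.
Proof.
move=> [g0 gfin]; rewrite /mean fineK// ge0_fin_numE//.
by apply: esum_ge0 => i _; exact: term_ge0.
Qed.

Lemma has_mean_le g g' : has_mean w g -> (forall i, 0 <= g' i <= g i) ->
  has_mean w g'.
Proof.
move=> [g0 gfin] gg'; split; first by move=> i; case/andP: (gg' i).
apply: le_lt_trans gfin; apply: le_esum => i _.
by rewrite lee_fin ler_wpM2r//; case/andP: (gg' i).
Qed.

Lemma mean_le g g' : has_mean w g -> (forall i, 0 <= g' i <= g i) ->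
  mean w g' <= mean w g.
Proof.
move=> hg gg'; have hg' := has_mean_le hg gg'.
rewrite -lee_fin -!meanE//; apply: le_esum => i _.
by rewrite lee_fin ler_wpM2r//; case/andP: (gg' i).
Qed.

Lemma mean_ge0 g : has_mean w g -> 0 <= mean w g.
Proof.
move=> hg; rewrite -lee_fin -meanE//; apply: esum_ge0 => i _.
by apply: term_ge0; case: hg.
Qed.

Lemma has_meanD g g' : has_mean w g -> has_mean w g' ->
  has_mean w (fun i => g i + g' i).
Proof.
move=> [g0 gfin] [g'0 g'fin]; split=> [i|]; first exact: addr_ge0.
under eq_esum do rewrite mulrDl EFinD.
by rewrite esumD ?lte_add_pinfty// => i _; exact: term_ge0.
Qed.

Lemma meanD g g' : has_mean w g -> has_mean w g' ->
  mean w (fun i => g i + g' i) = mean w g + mean w g'.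
Proof.
move=> hg hg'; apply: EFin_inj; rewrite -meanE; last exact: has_meanD.
under eq_esum do rewrite mulrDl EFinD.
rewrite esumD; first by rewrite EFinD !meanE.
  by move=> i _; apply: term_ge0; case: hg.
by move=> i _; apply: term_ge0; case: hg'.
Qed.

Let esumZ_le (c : R) (f : I -> R) : 0 <= c -> (forall i, 0 <= f i) ->
  (\esum_(i in [set: I]) (c * f i)%:E <=
   c%:E * \esum_(i in [set: I]) (f i)%:E)%E.
Proof.
move=> c0 f0; apply: ge_ereal_sup => /= _ [X [finX XI]] <-.
under eq_fsbigr do rewrite EFinM.
rewrite -ge0_mule_fsumr; last by move=> i; rewrite lee_fin.
by rewrite lee_wpmul2l ?lee_fin//; apply: esum_ge; exists X.
Qed.

Lemma has_meanZ (c : R) g : 0 <= c -> has_mean w g ->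
  has_mean w (fun i => c * g i).
Proof.
move=> c0 hg; have [g0 gfin] := hg; split=> [i|]; first exact: mulr_ge0.
under eq_esum do rewrite -mulrA.
apply: le_lt_trans (esumZ_le c0 _) _ => [i|]; first exact: mulr_ge0.
by rewrite (meanE hg) -EFinM ltry.
Qed.

Let meanZ_le (c : R) g : 0 <= c -> has_mean w g ->
  mean w (fun i => c * g i) <= c * mean w g.
Proof.
move=> c0 hg; have [g0 gfin] := hg; rewrite -lee_fin -meanE; last exact: has_meanZ.
rewrite EFinM -meanE//; under eq_esum do rewrite -mulrA.
by apply: esumZ_le => // i; exact: mulr_ge0.
Qed.

(** [meanZ_le] gives one inequality; for [c > 0] the other is [meanZ_le] again, for the constant
    [c^-1] and the function [c * g]. *)
Lemma meanZ (c : R) g : 0 <= c -> has_mean w g ->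
  mean w (fun i => c * g i) = c * mean w g.
Proof.
rewrite le_eqVlt => /orP[/eqP <- hg|c0 hg].
  rewrite mul0r /mean esum1// => i _; by rewrite !mul0r.
apply/eqP; rewrite eq_le meanZ_le ?(ltW c0)//= mulrC -ler_pdivlMr// mulrC.
have := @meanZ_le c^-1 _ _ (has_meanZ (ltW c0) hg).
rewrite invr_ge0 (ltW c0) => /(_ isT); apply: le_trans.
rewrite le_eqVlt; apply/orP; left; apply/eqP; congr mean; apply/funext => i.
by rewrite mulKf// gt_eqF.
Qed.

Lemma has_mean1 : has_mean w (fun=> 1).
Proof.
split=> // ; under eq_esum do rewrite mul1r.
by case: w_pmf => _ ->; exact: ltry.
Qed.

Lemma mean1 : mean w (fun=> 1) = 1.
Proof.
apply: EFin_inj; rewrite -meanE; last exact: has_mean1.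
by under eq_esum do rewrite mul1r; case: w_pmf.
Qed.

Lemma has_mean_bounded g (M : R) : (forall i, 0 <= g i <= M) -> has_mean w g.
Proof.
move=> gM; have [i0|noI] := pselect (exists i : I, True); last first.
  split=> [i|]; first by exfalso; apply: noI; exists i.
  by rewrite esum1 ?ltry// => i _; exfalso; apply: noI; exists i.
have M0 : 0 <= M by case: i0 => i _; case/andP: (gM i) => /le_trans; apply.
apply: has_mean_le (has_meanZ M0 has_mean1) _ => i.
by rewrite mulr1.
Qed.

Lemma mean_cst (c : R) : 0 <= c -> mean w (fun=> c) = c.
Proof.
move=> c0; rewrite -[RHS]mulr1 -mean1 -meanZ//; last exact: has_mean1.
by congr mean; apply/funext => i; rewrite mulr1.
Qed.

Lemma mean_le_cst g (M : R) : (forall i, 0 <= g i <= M) -> mean w g <= M.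
Proof.
move=> gM; have [i0|noI] := pselect (exists i : I, True); last first.
  exfalso; case: w_pmf => _ /eqP; rewrite esum1 ?eqe ?(eq_sym 0)?oner_eq0//.
  by move=> i _; exfalso; apply: noI; exists i.
have M0 : 0 <= M by case: i0 => i _; case/andP: (gM i) => /le_trans; apply.
rewrite -[leRHS]mean_cst//; apply: mean_le => //.
by apply: (@has_mean_bounded _ M) => i; rewrite M0 lexx.
Qed.

Lemma mean_point g i : has_mean w g -> g i * w i <= mean w g.
Proof.
move=> hg; have [g0 _] := hg; rewrite -lee_fin -meanE//; apply: esum_ge.
exists [set i]; first by split.
by rewrite fsbig_set1.
Qed.

Lemma mean_indic i : mean w (fun j => (j == i)%:R) = w i.
Proof.
apply: EFin_inj; rewrite -meanE; last first.
  by apply: (@has_mean_bounded _ 1) => j; case: eqP => _; rewrite ?lexx ?ler01.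
rewrite -(@esum_set1 R I i (fun j => (w j)%:E)); last by rewrite lee_fin.
rewrite [RHS]esum_mkcond; apply: eq_esum => j _.
by case: eqP => [->|ij]; [rewrite mul1r mem_set|rewrite mul0r memNset].
Qed.

Lemma mean_splitP g (D : pred I) : has_mean w g ->
  mean w g = mean w (fun i => if D i then g i else 0)
           + mean w (fun i => if D i then 0 else g i).
Proof.
move=> hg; have [g0 _] := hg; rewrite -meanD.
- by congr mean; apply/funext => i; case: (D i); rewrite ?addr0 ?add0r.
- by apply: has_mean_le hg _ => i; case: (D i); rewrite ?lexx ?g0.
- by apply: has_mean_le hg _ => i; case: (D i); rewrite ?lexx ?g0.
Qed.

Lemma has_mean_fin g (x : R) : (forall i, 0 <= g i) ->
  \esum_(i in [set: I]) (g i * w i)%:E = x%:E -> has_mean w g /\ mean w g = x.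
Proof. by move=> g0 e; rewrite /has_mean /mean e; split=> //; split; rewrite ?ltry. Qed.

End mean.

Section dexpect.
Context {R : realType} {I : choiceType} (w : I -> R).
Hypothesis w_pmf : is_pmf w.

Lemma dexpect_ge0 f : (forall i, 0 <= f i) ->
  dexpect w f = \esum_(i in [set: I]) (f i * w i)%:E.
Proof.
move=> f0; rewrite /dexpect [X in (_ - X)%E]esum1 ?sube0 => [|i _].
  by apply: eq_esum => i _; rewrite max_l.
by rewrite max_r ?mul0r// oppr_le0.
Qed.

(** Since [+oo - +oo = -oo], the difference is finite only when both parts are. *)
Lemma dexpect_EFin f (x : R) : dexpect w f = x%:E ->
  [/\ has_mean w (fun i => Num.max (f i) 0),
      has_mean w (fun i => Num.max (- f i) 0)
    & mean w (fun i => Num.max (f i) 0) - mean w (fun i => Num.max (- f i) 0) = x].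
Proof.
have w0 i : 0 <= w i by case: w_pmf.
have max0 (z : R) : 0 <= Num.max z 0 by rewrite le_max lexx orbT.
have e0 g : (0 <= \esum_(i in [set: I]) (Num.max (g i) 0 * w i)%:E)%E.
  by apply: esum_ge0 => i _; rewrite lee_fin mulr_ge0.
rewrite /dexpect /has_mean /mean.
have := e0 f; have := e0 (fun i => - f i).
case: esum => [u| |]//; case: esum => [v| |]// _ _ /= [<-].
by split=> //; split=> //; rewrite ltry.
Qed.

Lemma eq_mean_supp g g' : (forall i, w i != 0 -> g i = g' i) ->
  mean w g = mean w g'.
Proof.
move=> gg'; rewrite /mean; congr fine; apply: eq_esum => i _.
by have [->|wi] := eqVneq (w i) 0; [rewrite !mulr0|rewrite gg'].
Qed.

End dexpect.

Lemma mean_le_supp (R : realType) (I : choiceType) (w g g' : I -> R) :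
  is_pmf w -> has_mean w g -> (forall i, w i != 0 -> 0 <= g' i <= g i) ->
  mean w g' <= mean w g.
Proof.
move=> w_pmf hg gg'.
have -> : mean w g' = mean w (fun i => if w i == 0 then 0 else g' i).
  by apply: eq_mean_supp => i /negbTE ->.
apply: mean_le => // i; case: eqVneq => [_|wi]; last exact: gg'.
by case: hg => g0 _; rewrite lexx g0.
Qed.

(** * The law of the maximum through its recursion *)

Section countable_partition.
Context {d : measure_display} {T : measurableType d} {R : realType}.

Lemma measurable_preimage_countType (Y : countType) (Z : T -> Y) (D : set Y) :
  (forall y, measurable (Z @^-1` [set y])) -> measurable (Z @^-1` D).
Proof.
move=> mZ; have -> : Z @^-1` D =
    \bigcup_(i in [set i | exists2 y, D y & pickle y = i])
      (Z @^-1` [set y | pickle y = i]).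
  apply/seteqP; split=> [w Dw|w [i [y Dy <-] /=]].
    by exists (pickle (Z w)) => //; exists (Z w).
  by move/(pcan_inj (@pickleK _)) => Zw; rewrite /preimage/= Zw.
apply: bigcup_measurable => i [y Dy <-].
rewrite (_ : [set _ | _] = [set y]); first exact: mZ.
by apply/seteqP; split=> z /= => [/(pcan_inj (@pickleK _))|->].
Qed.

(** Countable additivity over [nat] is transferred to [Y] by coding the values of [Z] with
    [pickle]. *)
Lemma measure_countable_partition (mu : {measure set T -> \bar R})
    (Y : countType) (Z : T -> Y) (E : set T) :
  (forall y, measurable (Z @^-1` [set y])) -> measurable E ->
  mu E = \esum_(y in [set: Y]) mu (E `&` Z @^-1` [set y]).
Proof.
move=> mZ mE; pose F i := E `&` Z @^-1` [set y | pickle y = i].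
pose D : set nat := range (@pickle Y).
have mF i : measurable (F i).
  by apply: measurableI => //; exact: measurable_preimage_countType.
have {1}-> : E = \bigcup_(i in D) F i.
  apply/seteqP; split=> [w Ew|w [i _ []]//].
  by exists (pickle (Z w)) => //; exists (Z w).
rewrite measure_bigcup//; last first.
  apply/trivIsetP => i j _ _ ij; apply/seteqP; split=> w //.
  by move=> [[_ +] [_ +]]; rewrite /preimage/= => -> /eqP; rewrite (negbTE ij).
rewrite nneseries_esum//.
rewrite (_ : [set x | x \in D] = D); last by apply/seteqP; split=> x /=; rewrite inE.
rewrite (@reindex_esum R Y nat [set: Y] D (@pickle Y)); last first.
  split; [by move=> y _; exists y|by move=> y z _ _ /(pcan_inj (@pickleK _))|].
  by move=> _ [y _ <-]; exists y.
apply: eq_esum => y _; congr (mu (_ `&` _)).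
apply/seteqP; split=> w; rewrite /preimage/=; last by move=> ->.
exact: (pcan_inj (@pickleK Y)).
Qed.

End countable_partition.

(** Tonelli for an independent pair, used for a jump and an offspring number; [c] stands for the
    probability of everything else. *)
Lemma esum_pair_mean (R : realType) (I J : choiceType) (w1 : I -> R)
    (w2 : J -> R) (f : I -> J -> R) (c : R) :
  is_pmf w1 -> is_pmf w2 -> (forall i j, 0 <= f i j <= 1) -> 0 <= c ->
  \esum_(z in [set: I * J]) (w1 z.1 * w2 z.2 * f z.1 z.2 * c)%:E =
  (mean w1 (fun i => mean w2 (f i)) * c)%:E.
Proof.
move=> w1p w2p f01 c0.
have f0 i j : 0 <= f i j by case/andP: (f01 i j).
have hf i : has_mean w2 (f i) by apply: (has_mean_bounded w2p (f01 i)).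
have m01 i : 0 <= mean w2 (f i) <= 1.
  by rewrite mean_ge0//= mean_le_cst.
have hm := has_mean_bounded w1p m01.
have hmc := has_meanZ w1p c0 hm.
rewrite mulrC -(meanZ w1p c0 hm) -(meanE w1p hmc).
have -> : [set: I * J] = [set: I] `*`` (fun=> [set: J]) by apply/seteqP.
rewrite -(esum_esum (a := fun i j => (w1 i * w2 j * f i j * c)%:E)); last first.
  by move=> i j _ _; rewrite lee_fin !mulr_ge0//; [case: w1p|case: w2p].
apply: eq_esum => i _.
have wc : 0 <= w1 i * c by rewrite mulr_ge0//; case: w1p.
have -> : c * mean w2 (f i) * w1 i = w1 i * c * mean w2 (f i) by ring.
rewrite -(meanZ w2p wc)// -(meanE w2p); last first.
  exact: has_meanZ.
by apply: eq_esum => j _; congr (_%:E); ring.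
Qed.

(* An antichain of labels none of which is a prefix of a label of [s]: the
   subtrees rooted there involve pairwise disjoint sets of labels, all disjoint
   from [s]. *)
Definition fresh (s V : seq label) : Prop :=
  [/\ uniq s, uniq V, {in V &, forall v v', prefix v v' -> v = v'}
    & {in V & s, forall v u, ~~ prefix v u}].

Lemma prefix_rconsl (T : eqType) (v u : seq T) j :
  prefix (rcons v j) u -> prefix v u.
Proof. by apply: prefix_trans; exact: prefix_rcons. Qed.

Lemma prefix_rconsr (T : eqType) (v u : seq T) j :
  prefix u (rcons v j) -> u = rcons v j \/ prefix u v.
Proof.
move=> /prefixP[t]; case/lastP: t => [|t x]; first by rewrite cats0 => ->; left.
rewrite -rcons_cat => /rcons_inj[-> _]; right; exact: prefix_prefix.
Qed.

(** Exploring [v] adds it to the revealed labels and puts its children in its place. A prefix of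
    [rcons v j] is that label itself or a prefix of [v], so the old comparisons settle the new
    ones. *)
Lemma fresh_children s v V1 V2 k : fresh s (v :: V1 ++ V2) ->
  fresh (v :: s) (V1 ++ [seq rcons v j | j <- iota 0 k] ++ V2).
Proof.
move=> [us /= /andP[vV uV] VV Vs].
have vin : v \in v :: V1 ++ V2 by rewrite mem_head.
have inV u : u \in V1 ++ V2 -> u \in v :: V1 ++ V2 by rewrite in_cons => ->; rewrite orbT.
have memE u : u \in V1 ++ [seq rcons v j | j <- iota 0 k] ++ V2 ->
    (u \in V1 ++ V2) \/ (exists j, u = rcons v j).
  rewrite !mem_cat => /or3P[uV1|/mapP[j _ ->]|uV2].
  - by left; rewrite uV1.
  - by right; exists j.
  - by left; rewrite uV2 orbT.
have nvV u : u \in V1 ++ V2 -> ~~ prefix v u.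
  move=> uin; apply/negP => vu; move: vV.
  by rewrite (VV _ _ vin (inV _ uin) vu) uin.
have nVv u : u \in V1 ++ V2 -> ~~ prefix u v.
  move=> uin; apply/negP => vu; move: vV.
  by rewrite -(VV _ _ (inV _ uin) vin vu) uin.
have nch u : u \in V1 ++ V2 -> u \notin [seq rcons v j | j <- iota 0 k].
  move=> uin; apply/negP => /mapP[j _ uE].
  by move: (nvV _ uin); rewrite uE prefix_rcons.
split.
- rewrite /= us andbT; apply/negP => vs.
  by have := Vs _ _ vin vs; rewrite prefix_refl.
- rewrite uniq_catCA cat_uniq uV andbT map_inj_uniq ?iota_uniq/=; last first.
    by move=> i j /rcons_inj[].
  by apply/hasPn => u uin; exact: nch.
- move=> u u' /memE[uin|[j uE]] /memE[u'in|[j' u'E]] uu'.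
  + by apply: VV => //; exact: inV.
  + rewrite u'E in uu' *; case: (prefix_rconsr uu') => // /negPn.
    by rewrite nVv.
  + by move: uu'; rewrite uE => /prefix_rconsl/negPn; rewrite nvV.
  + move: uu'; rewrite uE u'E => /prefix_rconsr[//|/size_prefix].
    by rewrite size_rcons ltnn.
- move=> u t /memE[uin|[j uE]]; rewrite in_cons => /orP[/eqP ->|ts].
  + exact: nVv.
  + by apply: Vs => //; exact: inV.
  + by rewrite uE; apply/negP => /size_prefix; rewrite size_rcons ltnn.
  + rewrite uE; apply/negP => /prefix_rconsl/negPn; rewrite Vs//.
Qed.

Section below.
Context {R : realType} (a : int -> R) (p : nat -> R).
Hypotheses (a_pmf : is_pmf a) (p_pmf : is_pmf p).

(** The law of the maximum, [P (M_n < x)], in recursive form: after a jump [y], each of the [k]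
    children starts an independent copy that must stay below [x - y]. The value is 0 for [x <= 0]
    because the root sits at 0. *)
Fixpoint below (n : nat) (x : int) : R :=
  if 0 < x then
    if n is n'.+1 then mean a (fun y => mean p (fun k => below n' (x - y) ^+ k))
    else 1
  else 0.

Lemma below01 n x : 0 <= below n x <= 1.
Proof.
elim: n x => [|n IH] x /=; case: ifP => _; rewrite ?lexx ?ler01//.
have h k y : 0 <= below n (x - y) ^+ k <= 1.
  by have /andP[? ?] := IH (x - y); rewrite exprn_ge0//= exprn_ile1.
have h' y : 0 <= mean p (fun k => below n (x - y) ^+ k) <= 1.
  rewrite mean_le_cst// andbT; apply: mean_ge0 => //.
  exact: (has_mean_bounded p_pmf (fun k => h k y)).
rewrite mean_le_cst// andbT; apply: mean_ge0 => //.
exact: (has_mean_bounded a_pmf h').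
Qed.

Lemma below_le0 n x : x <= 0 -> below n x = 0.
Proof. by move=> x0; case: n => [|n] /=; rewrite ltNge x0. Qed.

Lemma belowS n x : 0 < x ->
  below n.+1 x = mean a (fun y => mean p (fun k => below n (x - y) ^+ k)).
Proof. by move=> /= ->. Qed.

Lemma below0 x : 0 < x -> below 0 x = 1.
Proof. by move=> /= ->. Qed.

End below.
Arguments below : simpl never.

(** * Probabilities of tree events by exploration of the labels *)

Section bridge.
Context {d : measure_display} {T : measurableType d} {R : realType}.
Context (P : probability T R) (xi : label -> T -> int) (N : label -> T -> nat).
Context (a : int -> R) (p : nat -> R).
Hypotheses (a_pmf : is_pmf a) (p_pmf : is_pmf p) (brw : is_brw P xi N a p).

(* The subtree rooted at [v] stays below [x], relative to the position of [v],
   for [n] generations. *)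
Fixpoint low (n : nat) (v : label) (x : int) (w : T) : Prop :=
  0 < x /\ if n is n'.+1 then
    forall j, (j < N v w)%N -> low n' (rcons v j) (x - xi v w) w
  else True.

(** Induction on [n]: a path [j :: u] from [v] is the path [u] from the child [rcons v j], with the
    jump of [v] subtracted from the level. *)
Lemma lowP n v x w : low n v x w <->
  forall u : label,
    (forall i, (i < size u)%N -> (nth 0 u i < N (v ++ take i u) w)%N) ->
    (size u <= n)%N -> \sum_(0 <= i < size u) xi (v ++ take i u) w < x.
Proof.
elim: n v x => [|n IH] v x /=.
  split=> [[x0 _] u _|h].
    by rewrite leqn0 => /eqP ->; rewrite big_geq.
  by split=> //; have := h [::]; rewrite /= big_geq//; apply.
split=> [[x0 h] [|j u] tu su|h].
- by rewrite big_geq.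
- have jN : (j < N v w)%N by have := tu 0; rewrite /= cats0; apply.
  have := (IH _ _).1 (h j jN) u.
  rewrite /= big_nat_recl//= cats0 ltrBrDl.
  under eq_bigr do rewrite cat_rcons.
  apply; last by rewrite -ltnS.
  by move=> i iu; have := tu i.+1 iu; rewrite /= -cat_rcons.
- split=> [|j jN].
    by have := h [::]; rewrite /= big_geq//; apply.
  apply/IH => u tu su; have := h (j :: u).
  rewrite /= big_nat_recl//= cats0 ltrBrDl.
  under [in X in _ -> X]eq_bigr do rewrite cat_rcons.
  apply; last by rewrite ltnS.
  by move=> [|i] iu /=; rewrite ?cats0// -cat_rcons; apply: tu.
Qed.

Let step v w : int * nat := (xi v w, N v w).

Let measurable_step v z : measurable (step v @^-1` [set z]).
Proof.
case: z => y k; rewrite (_ : _ @^-1` _ = xi v @^-1` [set y] `&` N v @^-1` [set k]).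
  by apply: measurableI; [exact: (brw_jump_measurable brw)|exact: (brw_offspring_measurable brw)].
by apply/seteqP; split=> w; rewrite /preimage /step/= => -[-> ->].
Qed.

Lemma measurable_low n v x : measurable [set w | low n v x w].
Proof.
elim: n v x => [|n IH] v x /=.
  case: (ltP 0 x) => x0.
    by rewrite (_ : mkset _ = setT)//; apply/seteqP; split.
  by rewrite (_ : mkset _ = set0)//; apply/seteqP; split=> // w [].
case: (ltP 0 x) => x0; last first.
  by rewrite (_ : mkset _ = set0)//; apply/seteqP; split=> // w [].
rewrite (_ : mkset _ = \bigcup_i (if unpickle i is Some z then
    step v @^-1` [set z] `&`
    \bigcap_(j in [set j | (j < z.2)%N]) [set w | low n (rcons v j) (x - z.1) w]
  else set0)).
  apply: bigcupT_measurable => i; case: unpickle => [z|//].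
  apply: measurableI; first exact: measurable_step.
  by apply: bigcap_measurableType => j _; exact: IH.
apply/seteqP; split=> [w [_ h]|w [i _]] /=.
  exists (pickle (step v w)); first exact: Logic.I.
  by rewrite pickleK; split; [exact: erefl|move=> j; exact: h].
case: unpickle => [z [<- h]|//]; split=> // j jN; exact: (h j).
Qed.

Definition cylinder (s : seq label) (A : label -> set int) (B : label -> set nat)
  : set T :=
  \bigcap_(v in [set` s]) (xi v @^-1` A v `&` N v @^-1` B v).

Definition all_low n (L : seq (label * int)) : set T :=
  [set w | forall u, u \in L -> low n u.1 u.2 w].

Lemma measurable_all_low n L : measurable (all_low n L).
Proof.
rewrite (_ : all_low n L = \bigcap_(u in [set` L]) [set w | low n u.1 u.2 w]).
  rewrite bigcap_seq; apply: big_ind => //; first exact: measurableI.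
  by move=> u _; exact: measurable_low.
by apply/seteqP; split.
Qed.

Lemma measurable_cylinder s A B : measurable (cylinder s A B).
Proof.
rewrite /cylinder bigcap_seq; apply: big_ind => //; first exact: measurableI.
move=> v _; apply: measurableI; apply: measurable_preimage_countType => y.
  exact: (brw_jump_measurable brw).
exact: (brw_offspring_measurable brw).
Qed.

Let set_at (Y : Type) v (y : Y) (A : label -> set Y) u :=
  if u == v then [set y] else A u.

Let cylinder_cons s A B v y k : v \notin s ->
  cylinder (v :: s) (set_at v y A) (set_at v k B) =
  cylinder s A B `&` step v @^-1` [set (y, k)].
Proof.
move=> vs; apply/seteqP; split=> [w h|w [h [yE kE]] u].
  split=> [u us|].
    have := h u; rewrite /= in_cons us orbT => /(_ isT).
    by rewrite /set_at (negbTE (memPn vs _ us)).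
  have := h v; rewrite /= mem_head => /(_ isT).
  by rewrite /set_at eqxx /step /preimage/= => -[-> ->].
rewrite /= in_cons /set_at; case: eqVneq => [-> _|uv /= us]; last exact: h.
by rewrite /preimage/= yE kE.
Qed.

Let measure_cylinder_cons s A B v y k : uniq s -> v \notin s ->
  P (cylinder (v :: s) (set_at v y A) (set_at v k B)) =
  ((a y * p k)%:E * P (cylinder s A B))%E.
Proof.
move=> us vs; rewrite /cylinder !(brw_independent brw)//=; last by rewrite vs.
rewrite big_cons {1 2}/set_at eqxx (brw_jump_law brw) (brw_offspring_law brw) EFinM.
congr (_ * _%:E)%E; apply: eq_big_seq => u us'.
by rewrite /set_at (negbTE (memPn vs _ us')).
Qed.

Local Notation bl := (below a p).

(* The roots in [L1] are explored one at a time: revealing [xi v] and [N v] turns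
   the constraint [(v, x)] for [n.+1] generations into the constraints
   [(rcons v j, x - xi v)], [j < N v], for [n] generations. *)
Let prob_all_low_mixed n :
  (forall L s A B, fresh s [seq u.1 | u <- L] ->
    P (cylinder s A B `&` all_low n L) =
    (P (cylinder s A B) * (\prod_(u <- L) bl n u.2)%:E)%E) ->
  forall L1 L2 s A B, fresh s ([seq u.1 | u <- L1] ++ [seq u.1 | u <- L2]) ->
    P (cylinder s A B `&` (all_low n.+1 L1 `&` all_low n L2)) =
    (P (cylinder s A B) *
      (\prod_(u <- L1) bl n.+1 u.2 * \prod_(u <- L2) bl n u.2)%:E)%E.
Proof.
move=> IHn; elim=> [|[v x] L1 IH] L2 s A B fr.
  rewrite (_ : all_low n.+1 [::] = setT) ?setTI ?big_nil ?mul1r//; last by apply/seteqP.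
  exact: IHn.
have := fr => -[us /= /andP[vV uV] VV Vs].
have vs : v \notin s.
  by apply/negP => vs; have := Vs v v (mem_head _ _) vs; rewrite prefix_refl.
(* For [x <= 0] the constraint at [v] is impossible and both sides vanish. *)
rewrite big_cons [(v, x).2]/=; case: (ltP 0 x) => x0; last first.
  rewrite (below_le0 _ _ _ x0) !mul0r mule0 (_ : _ `&` _ = set0) ?measure0//.
  apply/seteqP; split=> // w [_ [/(_ (v, x) (mem_head _ _))[+ _]]].
  by rewrite ltNge x0.
rewrite belowS//.
rewrite (@measure_countable_partition _ _ _ P _ (step v))//; last first.
  by apply: measurableI; [exact: measurable_cylinder|
     apply: measurableI; exact: measurable_all_low].
set c := fine (P (cylinder s A B)) * (\prod_(u <- L1) bl n.+1 u.2 * \prod_(u <- L2) bl n u.2).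
have c0 : 0 <= c.
  rewrite /c !mulr_ge0 ?fine_ge0//; apply: prodr_ge0 => u _;
  by case/andP: (below01 a_pmf p_pmf n u.2); case/andP: (below01 a_pmf p_pmf n.+1 u.2).
have f01 y k : 0 <= bl n (x - y) ^+ k <= 1.
  by have /andP[? ?] := below01 a_pmf p_pmf n (x - y); rewrite exprn_ge0//= exprn_ile1.
transitivity (mean a (fun y => mean p (fun k => bl n (x - y) ^+ k)) * c)%:E; last first.
  rewrite -[P (cylinder s A B)]fineK ?fin_num_measure//; last exact: measurable_cylinder.
  by rewrite -EFinM /c; congr (_%:E); ring.
rewrite -(esum_pair_mean a_pmf p_pmf f01 c0); apply: eq_esum => -[y k] _ /=.
pose L2' := [seq (rcons v j, x - y) | j <- iota 0 k] ++ L2.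
have L2E : [seq u.1 | u <- L2'] = [seq rcons v j | j <- iota 0 k] ++ [seq u.1 | u <- L2].
  by rewrite map_cat -map_comp.
(* On the slice [step v = (y, k)], the constraint at [v] is equivalent to those of its [k] children
   in [L2'], and the slice itself is absorbed into the cylinder. *)
transitivity (P (cylinder (v :: s) (set_at v y A) (set_at v k B) `&`
   (all_low n.+1 L1 `&` all_low n L2'))).
  congr (P _); rewrite cylinder_cons//; apply/seteqP; split=> w.
    move=> [[h [h1 h2]] st]; split; [by []|split].
      by move=> u uL; apply: h1; rewrite in_cons uL orbT.
    move=> u; rewrite mem_cat => /orP[/mapP[j + ->]/=|]; last exact: h2.
    rewrite mem_iota /= add0n => jk.
    have [_] := h1 (v, x) (mem_head _ _).
    move: st; rewrite /step /preimage/= => -[<- kE]; apply; by rewrite kE.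
  move=> [[h st] [h1 h2]]; split; [split; [exact: h|split]|exact: st].
    move=> u; rewrite in_cons => /orP[/eqP ->/=|]; last exact: h1.
    split=> // j; move: st; rewrite /step /preimage/= => -[-> ->] jk.
    apply: (h2 (rcons v j, x - y)); rewrite mem_cat; apply/orP; left.
    by apply/mapP; exists j => //; rewrite mem_iota.
  by move=> u uL; apply: h2; rewrite mem_cat uL orbT.
rewrite IH; last by rewrite L2E; exact: fresh_children.
rewrite measure_cylinder_cons//.
rewrite -[P (cylinder s A B)]fineK ?fin_num_measure//; last exact: measurable_cylinder.
rewrite /L2' big_cat big_map/= big_const_seq count_predT size_iota iter_mulr_1.
by rewrite -!EFinM /c; congr (_%:E); ring.
Qed.

(** The cylinder on revealed labels makes the induction go through, since an explored root joins it.
    The case [n.+1] is the mixed statement with [L2] empty. *)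
Lemma prob_all_low n L s A B : fresh s [seq u.1 | u <- L] ->
  P (cylinder s A B `&` all_low n L) =
  (P (cylinder s A B) * (\prod_(u <- L) bl n u.2)%:E)%E.
Proof.
elim: n L s A B => [|n IHn] L s A B fr; last first.
  have := @prob_all_low_mixed n IHn L [::] s A B.
  rewrite big_nil mulr1 cats0 (_ : all_low n [::] = setT) ?setIT; last by apply/seteqP.
  exact.
have [/allP h|/allPn[u uL u0]] := boolP (all (fun u : label * int => 0 < u.2) L).
  rewrite (_ : all_low _ _ = setT) ?setIT; last first.
    by apply/seteqP; split=> // w _ u uL; split=> //; exact: h.
  by rewrite big1_seq ?mule1// => u /andP[_ uL]; rewrite below0//; exact: (h u uL).
rewrite (_ : all_low _ _ = set0); last first.
  by apply/seteqP; split=> // w /(_ u uL) [] u0'; rewrite u0' in u0.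
rewrite setI0 measure0 (big_rem u)//= below_le0 ?mul0r ?leNgt// mule0//.
Qed.

Lemma maxpos_upto_lt n (x : int) w :
  ((x%:~R : R)%:E <= maxpos_upto xi N n w)%E <-> ~ low n [::] x w.
Proof.
split=> [xM /lowP h|].
  (* Positions are integers, so those below [x] are at most [x - 1] and their supremum stays
     strictly below [x]. *)
  have : (maxpos_upto xi N n w <= ((x - 1)%:~R : R)%:E)%E.
    apply: ge_ereal_sup => _ [u [tu su] <-].
    by rewrite lee_fin ler_int lerBrDr lezD1; exact: h.
  by move=> /(le_trans xM); rewrite lee_fin ler_int; lia.
apply: contra_notP => /negP; rewrite -ltNge => Mx; apply/lowP => u tu su.
rewrite -(ltr_int R) -lte_fin; apply: le_lt_trans Mx.
by apply: ereal_sup_ubound; exists u.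
Qed.

Lemma prob_maxpos_upto n (x : int) :
  P [set w | ((x%:~R : R)%:E <= maxpos_upto xi N n w)%E] = (1 - bl n x)%:E.
Proof.
rewrite (_ : mkset _ = ~` [set w | low n [::] x w]); last first.
  by apply/seteqP; split=> w /=; rewrite maxpos_upto_lt.
rewrite probability_setC; last exact: measurable_low.
rewrite EFinB; congr (_ - _)%E.
have fr : fresh [::] [seq u.1 | u <- [:: ([::] : label, x)]].
  by split=> // v v'; rewrite !inE => /eqP -> /eqP ->.
have := prob_all_low n (fun=> setT) (fun=> setT) fr.
rewrite (_ : cylinder _ _ _ = setT); last by apply/seteqP; split.
rewrite setTI probability_setT mul1e big_seq1 => <-; congr (P _).
by apply/seteqP; split=> w /= => [h u|/(_ _ (mem_head _ _))//]; rewrite inE => /eqP ->.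
Qed.

Lemma measurable_maxpos_upto n (x : int) :
  measurable [set w | ((x%:~R : R)%:E <= maxpos_upto xi N n w)%E].
Proof.
rewrite (_ : mkset _ = ~` [set w | low n [::] x w]); last first.
  by apply/seteqP; split=> w /=; rewrite maxpos_upto_lt.
by apply: measurableC; exact: measurable_low.
Qed.

End bridge.

(** * Comparison with exponentials *)

Section powers.
Context {R : realFieldType}.

Lemma exprB_le_lin (s t : R) k : 0 <= s <= t -> t <= 1 ->
  t ^+ k - s ^+ k <= k%:R * (t - s).
Proof.
move=> /andP[s0 st] t1; elim: k => [|k IH]; first by rewrite !expr0 mul0r subrr.
have t0 : 0 <= t by exact: le_trans st.
have sk : s ^+ k <= 1 by rewrite exprn_ile1// (le_trans st).
have stk : s ^+ k <= t ^+ k by rewrite lerXn2r.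
rewrite !exprS -natr1; nra.
Qed.

(** Passing from [k] to [k + 1] adds [u * (1 - u) ^ k], which is at least [u - k * u ^ 2] by
    [exprB_le_lin]; the accumulated losses stay below [k ^ 2 * u ^ 2]. *)
Lemma lin_le_1Bexpr (u : R) k : 0 <= u <= 1 ->
  k%:R * u <= 1 - (1 - u) ^+ k + k%:R ^+ 2 * u ^+ 2.
Proof.
move=> /andP[u0 u1]; elim: k => [|k IH]; first by rewrite expr0 mul0r; lra.
have h : 1 ^+ k - (1 - u) ^+ k <= k%:R * (1 - (1 - u)) by apply: exprB_le_lin; lra.
have {}h : 1 - (1 - u) ^+ k <= k%:R * u by move: h; rewrite expr1n; lra.
have k0 : 0 <= k%:R :> R by [].
have e1 : (1 - u) ^+ k <= 1 by rewrite exprn_ile1//; lra.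
rewrite exprS -natr1; nra.
Qed.

Lemma le_exprzN (s s' : R) (x : int) : 1 <= s <= s' -> 0 <= x ->
  s' ^ (- x) <= s ^ (- x).
Proof.
move=> /andP[s1 ss] x0; case: x x0 => // k _.
have s0 : 0 < s by lra.
have s'0 : 0 < s' by lra.
rewrite -!exprz_inv -!exprnP lerXn2r ?nnegrE ?invr_ge0 ?(ltW s0) ?(ltW s'0)//.
by rewrite lef_pV2 ?posrE.
Qed.

End powers.

(** * Supersolutions and subsolutions of the recursion *)

Section recursion.
Context {R : realType} (a : int -> R) (p : nat -> R) (m : R).
Hypotheses (a_pmf : is_pmf a) (p_pmf : is_pmf p).
Hypotheses (p_mean : has_mean p (fun k => k%:R)) (p_meanE : mean p (fun k => k%:R) = m).
Hypothesis p_mean2 : has_mean p (fun k => k%:R ^+ 2).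
Hypothesis m_gt0 : 0 < m.

(** The function [q] of the overview: the probability that some child succeeds when each does so
    independently with probability [u]. *)
Definition hit (u : R) := mean p (fun k => 1 - (1 - u) ^+ k).

Let term01 (u : R) k : 0 <= u <= 1 -> 0 <= 1 - (1 - u) ^+ k <= 1.
Proof.
move=> /andP[u0 u1]; have : 0 <= 1 - u <= 1 by lra.
move=> /andP[v0 v1]; have := exprn_ge0 k v0; have := @exprn_ile1 _ k _ v0 v1; lra.
Qed.

Let has_term u : 0 <= u <= 1 -> has_mean p (fun k => 1 - (1 - u) ^+ k).
Proof. by move=> u01; apply: (has_mean_bounded p_pmf) => k; exact: term01. Qed.

Lemma hit01 u : 0 <= u <= 1 -> 0 <= hit u <= 1.
Proof.
move=> u01; rewrite (mean_ge0 p_pmf (has_term u01))/=.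
by apply: mean_le_cst => // k; exact: term01.
Qed.

Lemma le_hit u v : 0 <= v <= u -> u <= 1 -> hit v <= hit u.
Proof.
move=> /andP[v0 vu] u1.
apply: mean_le => //; first by apply: has_term; rewrite (le_trans v0).
move=> k; have /andP[-> _] /= : 0 <= 1 - (1 - v) ^+ k <= 1.
  by apply: term01; rewrite v0 (le_trans vu).
by rewrite lerD2l lerN2 lerXn2r// ?nnegrE; lra.
Qed.

(** On the unit interval [1 - (1 - u) ^ k] has slope at most [k], and the mean of [k] is [m]. *)
Lemma hit_lipschitz u v : 0 <= v <= u -> u <= 1 -> hit u <= hit v + m * (u - v).
Proof.
move=> /andP[v0 vu] u1.
have v01 : 0 <= v <= 1 by rewrite v0 (le_trans vu).
have uv : 0 <= u - v by lra.
rewrite mulrC -p_meanE /hit -meanZ// -meanD//; last 2 first.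
- exact: has_term.
- exact: has_meanZ.
apply: mean_le => //; first by apply: has_meanD => //; [exact: has_term|exact: has_meanZ].
move=> k; have /andP[-> _] /= : 0 <= 1 - (1 - u) ^+ k <= 1.
  by apply: term01; rewrite (le_trans v0).
have : (1 - v) ^+ k - (1 - u) ^+ k <= k%:R * (1 - v - (1 - u)).
  by apply: exprB_le_lin; lra.
lra.
Qed.

Lemma hit0 : hit 0 = 0.
Proof.
rewrite -[RHS](mean_cst p_pmf (lexx 0)) /hit; congr mean; apply/funext => k.
by rewrite subr0 expr1n subrr.
Qed.

Lemma hit_le_lin u : 0 <= u <= 1 -> hit u <= m * u.
Proof.
move=> /andP[u0 u1]; have := @hit_lipschitz u 0; rewrite lexx u0 hit0 add0r subr0.
exact.
Qed.

Definition moment2 := mean p (fun k => k%:R ^+ 2).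

Lemma moment2_ge0 : 0 <= moment2.
Proof. exact: mean_ge0. Qed.

Lemma lin_le_hit u : 0 <= u <= 1 -> m * u <= hit u + moment2 * u ^+ 2.
Proof.
move=> u01; have /andP[u0 u1] := u01.
rewrite mulrC -p_meanE /hit /moment2 (mulrC _ (u ^+ 2)).
rewrite -!meanZ// ?sqr_ge0// -meanD//; last 2 first.
- exact: has_term.
- by apply: has_meanZ => //; exact: sqr_ge0.
apply: mean_le => //.
  apply: has_meanD => //; first exact: has_term.
  by apply: has_meanZ => //; exact: sqr_ge0.
move=> k; rewrite mulr_ge0//=.
by have := lin_le_1Bexpr k u01; rewrite (mulrC u) (mulrC (u ^+ 2)).
Qed.

(** This is [h_n x] of the overview; [prob_maxpos_upto] ties it to the process. *)
Definition reach n x : R := 1 - below a p n x.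

Lemma reach01 n x : 0 <= reach n x <= 1.
Proof. by have := below01 a_pmf p_pmf n x; rewrite /reach; lra. Qed.

Lemma reach_le0 n x : x <= 0 -> reach n x = 1.
Proof. by move=> x0; rewrite /reach below_le0// subr0. Qed.

Lemma reach0 x : 0 < x -> reach 0 x = 0.
Proof. by move=> x0; rewrite /reach below0// subrr. Qed.

Lemma has_mean_hit (l : int -> R) x : (forall z, 0 <= l z <= 1) ->
  has_mean a (fun y => hit (l (x - y))).
Proof. by move=> l01; apply: (@has_mean_bounded _ _ a a_pmf _ 1) => y; exact: hit01. Qed.

Lemma reachS n x : 0 < x -> reach n.+1 x = mean a (fun y => hit (reach n (x - y))).
Proof.
move=> x0; rewrite [LHS]/reach belowS//; apply/eqP; rewrite subr_eq; apply/eqP.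
have b01 y k : 0 <= below a p n (x - y) ^+ k <= 1.
  have /andP[? ?] := below01 a_pmf p_pmf n (x - y).
  by rewrite exprn_ge0//= exprn_ile1.
have hb y := has_mean_bounded p_pmf (b01 y).
rewrite -meanD//; last 2 first.
- exact: (has_mean_hit x (reach01 n)).
- apply: (@has_mean_bounded _ _ a a_pmf _ 1) => y.
  by rewrite (mean_ge0 p_pmf (hb y))/= (mean_le_cst p_pmf (b01 y)).
rewrite -[LHS](mean1 a_pmf); congr mean; apply/funext => y; apply/esym.
rewrite -(meanD p_pmf (has_term (reach01 n (x - y))) (hb y)) -[RHS](mean1 p_pmf).
by congr mean; apply/funext => k; rewrite /reach (_ : 1 - (1 - _) = below a p n (x - y)) ?subrK//; ring.
Qed.

Lemma reach_nondecreasing x : nondecreasing_seq (reach^~ x).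
Proof.
apply/nondecreasing_seqP => n; elim: n x => [|n IH] x.
  have [x0|x0] := ltP 0 x; last by rewrite !reach_le0.
  by rewrite reach0//; case/andP: (reach01 1 x).
have [x0|x0] := ltP 0 x; last by rewrite !reach_le0.
rewrite !reachS//; apply: mean_le => //.
  exact: (has_mean_hit x (reach01 n.+1)).
move=> y; have /andP[-> _] /= := hit01 (reach01 n (x - y)).
have /andP[r0 _] := reach01 n (x - y); have /andP[_ r1] := reach01 n.+1 (x - y).
by apply: le_hit => //; rewrite r0 IH.
Qed.

Local Notation gen s := (mean a (fun y => s ^ y)).

Hypothesis gen_fin : forall s : R, 1 <= s -> has_mean a (fun y => s ^ y).

Lemma has_mean_tilt (s : R) x : 1 <= s -> has_mean a (fun y => s ^ (- (x - y))).
Proof.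
move=> s1; have s0 : 0 < s by lra.
rewrite (_ : (fun y => _) = fun y => s ^ (- x) * s ^ y).
  by apply: has_meanZ; rewrite ?exprz_ge0 ?ltW//; exact: gen_fin.
by apply/funext => y; rewrite opprB addrC expfzDr ?gt_eqF.
Qed.

(** Exponentials are eigenfunctions of averaging over one jump, with eigenvalue [gen s]. *)
Lemma mean_tilt (s : R) x : 1 <= s ->
  mean a (fun y => s ^ (- (x - y))) = gen s * s ^ (- x).
Proof.
move=> s1; have s0 : 0 < s by lra.
rewrite mulrC -meanZ//; [|by rewrite exprz_ge0 ?ltW|exact: gen_fin].
by congr mean; apply/funext => y; rewrite opprB addrC expfzDr ?gt_eqF.
Qed.

(** Induction on [n]: one generation multiplies the excess of [l] over [reach n] by at most [m], by
    [hit_lipschitz], and averaging the exponential contributes [gen t]. For [x <= 0], [reach] is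
    already 1. *)
Lemma reach_compare (t : R) (l : int -> R) : 1 <= t ->
  (forall x, 0 <= l x <= 1) ->
  (forall x, 0 < x -> l x <= mean a (fun y => hit (l (x - y)))) ->
  (forall x, 0 < x -> l x <= t ^ (- x)) ->
  forall n x, l x <= reach n x + (m * gen t) ^+ n * t ^ (- x).
Proof.
move=> t1 l01 lsub lt; have t0 : 0 < t by lra.
have tz z : 0 <= t ^ z by rewrite exprz_ge0// ltW.
have g0 : 0 <= m * gen t by rewrite mulr_ge0 ?(ltW m_gt0)// mean_ge0//; exact: gen_fin.
elim=> [|n IH] x; (have [x0|x0] := ltP 0 x; last by
  rewrite reach_le0//; have /andP[_ /le_trans] := l01 x; apply;
  rewrite lerDl mulr_ge0// exprn_ge0).
  by rewrite reach0// expr0 mul1r add0r; exact: lt.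
apply: (le_trans (lsub x x0)); rewrite reachS//.
set c := (m * gen t) ^+ n; have c0 : 0 <= c by exact: exprn_ge0.
have mc0 : 0 <= m * c by rewrite mulr_ge0 ?(ltW m_gt0).
rewrite exprSr -/c mulrA (mulrC c m) -mulrA -mean_tilt//.
have hh : has_mean a (fun y => hit (reach n (x - y))).
  exact: (has_mean_hit x (reach01 n)).
have ht := has_mean_tilt x t1.
rewrite -meanZ// -meanD//; last exact: has_meanZ.
apply: mean_le; first by []; first by apply: has_meanD => //; exact: has_meanZ.
move=> y; have /andP[-> _] /= := hit01 (l01 (x - y)).
have /andP[l0 l1] := l01 (x - y); have /andP[r0 r1] := reach01 n (x - y).
have ct : 0 <= c * t ^ (- (x - y)) by rewrite mulr_ge0.
have [lr|rl] := leP (l (x - y)) (reach n (x - y)).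
  apply: (@le_trans _ _ (hit (reach n (x - y)))); first by apply: le_hit => //; rewrite l0.
  by rewrite lerDl -mulrA mulr_ge0// ltW.
have h : 0 <= reach n (x - y) <= l (x - y) by rewrite r0 ltW.
apply: le_trans (hit_lipschitz h l1) _.
by rewrite lerD2l -mulrA ler_pM2l//; have := IH (x - y); rewrite -/c; lra.
Qed.

(** As [hit] lies below the line of slope [m], one generation costs at most the factor [m * gen s].
    The condition [1 <= mu] covers [x <= 0], where [reach] is 1. *)
Lemma reach_le (s mu : R) : 1 <= s -> 1 <= mu -> m * gen s <= mu ->
  forall n x, reach n x <= mu ^+ n * s ^ (- x).
Proof.
move=> s1 mu1 smu; have s0 : 0 < s by lra.
have sz z : 0 <= s ^ z by rewrite exprz_ge0// ltW.
have mu0 : 0 <= mu by lra.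
have le0 n x : x <= 0 -> reach n x <= mu ^+ n * s ^ (- x).
  move=> x0; rewrite reach_le0// -[leLHS]mulr1 ler_pM// ?exprn_ege1//.
  by case: x x0 => // [[|k]|k] _ //; rewrite ?NegzE ?opprK /= exprn_ege1.
elim=> [|n IH] x; (have [x0|x0] := ltP 0 x; last exact: le0).
  by rewrite reach0// mulr_ge0// exprn_ge0.
rewrite reachS//; have ht := has_mean_tilt x s1.
have c0 : 0 <= m * mu ^+ n by rewrite mulr_ge0 ?exprn_ge0// ltW.
apply: (@le_trans _ _ (mean a (fun y => m * mu ^+ n * s ^ (- (x - y))))).
  apply: mean_le; first by []; first exact: has_meanZ.
  move=> y; have /andP[-> _] /= := hit01 (reach01 n (x - y)).
  apply: le_trans (hit_le_lin (reach01 _ _)) _.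
  by rewrite -mulrA ler_pM2l.
rewrite meanZ// mean_tilt// mulrA ler_wpM2r//.
by rewrite exprS mulrAC ler_wpM2r// exprn_ge0.
Qed.

(** [reach_compare] is applied to [l = min 1 (e * G)]. The linear part of the recursion preserves
    [r ^ (- x)] exactly and multiplies [(r ^+ 2) ^ (- x)] by [m * gen (r ^+ 2) > 1]; this surplus
    pays for the quadratic loss. *)
Lemma reach_ge (r : R) : 1 < r -> m * gen r = 1 -> 1 < m * gen (r ^+ 2) ->
  exists2 e : R, 0 < e & forall t, 1 <= t <= r -> forall n x, 0 <= x ->
    e * r ^ (- x) <= reach n x + (m * gen t) ^+ n * t ^ (- x).
Proof.
move=> r1 mr mr2.
have r0 : 0 < r by lra.
have r2 : 1 <= r ^+ 2 by rewrite exprn_ege1// ltW.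
have r4 : 1 <= r ^+ 4 by rewrite exprn_ege1// ltW.
(* For [x > 0] the averaged quadratic loss is at most [e ^ 2 * D * (r ^+ 2) ^ (- x)]; the factor 2
   comes from squaring the two terms of [G]. *)
pose D := 2 * (moment2 + m) * (gen (r ^+ 2) + gen (r ^+ 4)).
have g2 : 0 <= gen (r ^+ 2) by apply: mean_ge0 => //; exact: gen_fin.
have g4 : 0 <= gen (r ^+ 4) by apply: mean_ge0 => //; exact: gen_fin.
have mm : 0 <= moment2 + m by rewrite addr_ge0 ?moment2_ge0 ?(ltW m_gt0).
have D0 : 0 <= D by rewrite /D !mulr_ge0// addr_ge0.
(* The bound [2^-1] keeps [l] below [r ^ (- x)] for [x > 0]; the other bound gives
   [e * D <= m * gen (r ^+ 2) - 1]. *)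
pose e := Num.min 2^-1 ((m * gen (r ^+ 2) - 1) / (D + 1)).
have e0 : 0 < e by rewrite lt_min invr_gt0 ltr0n/= divr_gt0//; lra.
have e2 : e <= 2^-1 by rewrite ge_min lexx.
have eD : e * D <= m * gen (r ^+ 2) - 1.
  apply: (@le_trans _ _ (e * (D + 1))); first by rewrite ler_wpM2l// ?ltW//; lra.
  by rewrite -ler_pdivlMr ?ge_min ?lexx ?orbT//; lra.
pose G (x : int) : R := r ^ (- x) + (r ^+ 2) ^ (- x).
have rz (s : R) z : 1 <= s -> 0 < s ^ z by move=> s1; rewrite exprz_gt0//; lra.
have G0 x : 0 < G x by rewrite addr_gt0 ?rz// ltW.
have pow2 (s : R) x : 1 <= s -> (s ^ (- x)) ^+ 2 = (s ^+ 2) ^ (- x).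
  by move=> s1; rewrite !expr2 expfzMl.
pose l x := Num.min 1 (e * G x).
have l01 x : 0 <= l x <= 1 by rewrite ge_min lexx/= andbT le_min ler01 mulr_ge0// ltW.
have lG x : l x <= e * G x by rewrite ge_min lexx orbT.
have r21 : 1 <= r <= r ^+ 2 by rewrite (ltW r1) ler_eXnr// ltW.
have GG x : G x ^+ 2 <= 2 * ((r ^+ 2) ^ (- x) + (r ^+ 4) ^ (- x)).
  have r42 : r ^+ 4 = (r ^+ 2) ^+ 2 by rewrite -exprM.
  have e1 := pow2 r x (ltW r1); have e2' := pow2 (r ^+ 2) x r2.
  rewrite r42 -e2' /G; have := sqr_ge0 (r ^ (- x) - (r ^+ 2) ^ (- x)).
  move: e1; move: (r ^ (- x)) ((r ^+ 2) ^ (- x)) => A B; lra.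
(* Where the truncation is active, [e * G z >= 1] and the linear term is dominated by its square;
   this accounts for the summand [m] next to [moment2]. *)
have main z : m * (e * G z) <= hit (l z) + (moment2 + m) * (e * G z) ^+ 2.
  have m20 := moment2_ge0; rewrite /l; case: (leP 1 (e * G z)) => eG.
    have /andP[h0 _] := @hit01 1 (introT andP (conj ler01 (lexx 1))).
    have : m * (e * G z) <= m * (e * G z) ^+ 2.
      by rewrite ler_pM2l// expr2 ler_peMl// (le_trans _ eG)// ler01.
    have : 0 <= moment2 * (e * G z) ^+ 2 by rewrite mulr_ge0// sqr_ge0.
    rewrite mulrDl; lra.
  have eG0 : 0 <= e * G z <= 1 by rewrite mulr_ge0 ?ltW//.
  by apply: le_trans (lin_le_hit eG0) _; rewrite lerD2l ler_wpM2r ?sqr_ge0// lerDl ltW.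
have lsub x : 0 < x -> l x <= mean a (fun y => hit (l (x - y))).
  move=> x0.
  have hh := has_mean_hit x l01.
  have t1 := has_mean_tilt x (ltW r1); have t2 := has_mean_tilt x r2.
  have t4 := has_mean_tilt x r4.
  have me0 : 0 <= m * e by rewrite mulr_ge0 ?ltW.
  pose c := 2 * (moment2 + m) * e ^+ 2.
  have c0 : 0 <= c by rewrite /c !mulr_ge0// ltW.
  have hG := has_meanD a_pmf t1 t2; have hG2 := has_meanD a_pmf t2 t4.
  have : mean a (fun y => m * e * G (x - y)) <=
      mean a (fun y => hit (l (x - y)) +
        c * ((r ^+ 2) ^ (- (x - y)) + (r ^+ 4) ^ (- (x - y)))).
    apply: mean_le; first by [].
      by apply: has_meanD => //; exact: has_meanZ.
    move=> y; rewrite mulr_ge0 ?(ltW (G0 _))//=.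
    rewrite -mulrA; apply: le_trans (main _) _; rewrite lerD2l exprMn /c.
    have := GG (x - y); have : 0 <= (moment2 + m) * e ^+ 2 by rewrite mulr_ge0// sqr_ge0.
    move=> h1 h2; have := ler_wpM2l h1 h2; lra.
  rewrite meanZ// meanD//; last exact: has_meanZ.
  rewrite meanZ// !meanD// !mean_tilt//; last exact: ltW.
  move=> h; apply: le_trans (lG x) _.
  have h2 : (r ^+ 4) ^ (- x) <= (r ^+ 2) ^ (- x).
    by apply: le_exprzN; [rewrite r2 ler_eXn2l|exact: ltW].
  have h3 : c * (gen (r ^+ 2) * (r ^+ 2) ^ (- x) + gen (r ^+ 4) * (r ^+ 4) ^ (- x)) <=
      e * (m * gen (r ^+ 2) - 1) * (r ^+ 2) ^ (- x).
    apply: (@le_trans _ _ (e * (e * D) * (r ^+ 2) ^ (- x))); last first.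
      by rewrite ler_wpM2r ?(ltW (rz _ _ _))// ler_pM2l.
    have -> : e * (e * D) * (r ^+ 2) ^ (- x) = c * (gen (r ^+ 2) * (r ^+ 2) ^ (- x) + gen (r ^+ 4) * (r ^+ 2) ^ (- x)).
      by rewrite /D /c; ring.
    by rewrite ler_wpM2l// lerD2l ler_wpM2l.
  have h4 : m * e * (gen r * r ^ (- x)) = e * r ^ (- x) by rewrite mulrACA mr mul1r.
  move: h; rewrite mulrDr h4 /G; lra.
exists e => // t /andP[t1 tr] n x x0.
have lt y : 0 < y -> l y <= t ^ (- y).
  move=> y0; apply: le_trans (lG y) _.
  apply: (@le_trans _ _ (r ^ (- y))); last by apply: le_exprzN; [rewrite t1|exact: ltW].
  have : (r ^+ 2) ^ (- y) <= r ^ (- y) by apply: le_exprzN => //; exact: ltW.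
  have := rz r (- y) (ltW r1); rewrite /G; nra.
apply: le_trans (reach_compare t1 l01 lsub lt n x).
rewrite /l le_min ler_pM2l// /G lerDl (ltW (rz _ _ _))// andbT.
have : r ^ (- x) <= 1.
  by rewrite -(exp1rz R (- x)); apply: le_exprzN => //; rewrite lexx ltW.
by have := rz r (- x) (ltW r1); nra.
Qed.

End recursion.

(** * The generating function of the jumps *)

Section bernoulli.
Context {R : realFieldType}.

Lemma bernoulli_nat (b : R) (n : nat) : 0 < b -> 1 + n%:R * (b - 1) <= b ^+ n.
Proof.
move=> b0; elim: n => [|n IH]; first by rewrite expr0; lra.
apply: (@le_trans _ _ (b * (1 + n%:R * (b - 1)))); last by rewrite exprS ler_pM2l.
have : 0 <= n%:R * (b - 1) ^+ 2 by rewrite mulr_ge0// sqr_ge0.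
rewrite -natr1; nra.
Qed.

(** A negative power of [b] is a natural power of [b^-1], and [b^-1 - 1 >= 1 - b]. *)
Lemma bernoulli_int (b : R) (y : int) : 0 < b -> 1 + y%:~R * (b - 1) <= b ^ y.
Proof.
move=> b0; case: y => n; first exact: bernoulli_nat.
rewrite NegzE -exprz_inv mulrNz -pmulrn.
have bi : 0 < b^-1 by rewrite invr_gt0.
apply: le_trans (bernoulli_nat n.+1 bi).
have h : 1 - b <= b^-1 - 1.
  have : 0 <= b^-1 * (b - 1) ^+ 2 by rewrite mulr_ge0 ?sqr_ge0// ltW.
  have -> : b^-1 * (b - 1) ^+ 2 = b - 2 + b^-1 by field; rewrite gt_eqF.
  lra.
have := ler_wpM2l (ler0n R n.+1) h; lra.
Qed.

(** The tangent at [u], supplied by [bernoulli_int], lies below the power at [s] and at [v]; with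
    weights [v - u] and [u - s] the linear terms cancel. *)
Lemma exprz_convex (s u v : R) (y : int) : 0 < s -> s <= u <= v ->
  u ^ y * (v - s) <= s ^ y * (v - u) + v ^ y * (u - s).
Proof.
move=> s0 /andP[su uv]; have u0 : 0 < u by lra.
have v0 : 0 < v by lra.
have uy : 0 < u ^ y by rewrite exprz_gt0.
have tang z : 0 < z -> u ^ y * (1 + y%:~R * (z / u - 1)) <= z ^ y.
  move=> z0; rewrite -{2}(divfK (lt0r_neq0 u0) z) expfzMl mulrC ler_pM2r//.
  by apply: bernoulli_int; rewrite divr_gt0.
have h1 := ler_wpM2r (_ : 0 <= v - u) (tang s s0).
have h2 := ler_wpM2r (_ : 0 <= u - s) (tang v v0).
apply: le_trans (lerD (h1 _) (h2 _)); [|lra|lra].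
rewrite le_eqVlt; apply/orP; left; apply/eqP; field.
by rewrite gt_eqF.
Qed.

End bernoulli.

Section generating_function.
Context {R : realType} (a : int -> R).
Hypothesis a_pmf : is_pmf a.

Lemma K_mean (s : R) : 1 <= s -> (K a s < +oo)%E ->
  has_mean a (fun y => s ^ y) /\ K a s = (mean a (fun y => s ^ y))%:E.
Proof.
move=> s1; have s0 y : 0 <= s ^ y by rewrite exprz_ge0//; lra.
rewrite /K dexpect_ge0// => fin.
have h : has_mean a (fun y => s ^ y) by split.
by rewrite (meanE a_pmf h).
Qed.

Local Notation gen s := (mean a (fun y => s ^ y)).
Hypothesis gen_fin : forall s : R, 1 <= s -> has_mean a (fun y => s ^ y).

Lemma gen1 : gen 1 = 1.
Proof. by rewrite -[RHS](mean1 a_pmf); congr mean; apply/funext => y; rewrite exp1rz. Qed.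

Lemma gen_convex (s u v : R) : 1 <= s -> s <= u <= v ->
  gen u * (v - s) <= gen s * (v - u) + gen v * (u - s).
Proof.
move=> s1 /andP[su uv].
have hs := gen_fin s1; have hu := gen_fin (le_trans s1 su).
have hv := gen_fin (le_trans s1 (le_trans su uv)).
have vs : 0 <= v - s by lra. have vu : 0 <= v - u by lra.
have us : 0 <= u - s by lra.
rewrite -!(mulrC (_ - _)) -!meanZ// -meanD//; try exact: has_meanZ.
apply: mean_le => //; first by apply: has_meanD => //; exact: has_meanZ.
move=> y; rewrite mulr_ge0 ?exprz_ge0//=; last by lra.
by rewrite ![(_ - _) * _]mulrC; apply: exprz_convex; [lra|rewrite su].
Qed.

Hypothesis a_mean : dexpect a (fun y => y%:~R) = 0%E.

(** Average the Bernoulli inequality: the linear term has mean zero. It is split into positive and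
    negative parts, which have equal means. *)
Lemma gen_ge1 (s : R) : 1 <= s -> 1 <= gen s.
Proof.
move=> s1; have [hp hn /eqP] := dexpect_EFin a_pmf a_mean.
rewrite subr_eq0 => /eqP e.
have s0 : 0 <= s - 1 by lra.
rewrite -(lerD2r ((s - 1) * mean a (fun y => Num.max (- y%:~R) 0))).
rewrite -{1}e -!meanZ// -{1}(mean1 a_pmf) -!meanD//;
  try by [exact: has_mean1|exact: has_meanZ|exact: gen_fin].
apply: mean_le => //; first by apply: has_meanD => //; [exact: gen_fin|exact: has_meanZ].
move=> y; have m0 (z : R) : 0 <= Num.max z 0 by rewrite le_max lexx orbT.
rewrite addr_ge0 ?mulr_ge0//=.
have b : 1 + y%:~R * (s - 1) <= s ^ y by apply: bernoulli_int; lra.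
have : (y%:~R : R) = Num.max y%:~R 0 - Num.max (- y%:~R) 0.
  by have [y0|y0] := leP 0 (y%:~R : R);
    [rewrite max_r ?oppr_le0// subr0
    |rewrite max_l ?oppr_ge0 ?ltW// sub0r opprK].
move: (Num.max _ _) (Num.max _ _) b => P N; nra.
Qed.

Lemma gen_le (s v : R) : 1 <= s <= v -> gen s <= gen v.
Proof.
move=> /andP[s1 sv]; have [->//|vs] := eqVneq v s.
have v1 : 1 < v by rewrite lt_neqAle (le_trans s1)// andbT; apply: contra_neq vs => v1; apply/eqP; rewrite eq_le sv -v1 s1.
have := @gen_convex 1 s v (lexx 1); rewrite s1 sv gen1 => /(_ isT).
have := gen_ge1 (ltW v1); nra.
Qed.

(** By convexity the slope on [[s, v]] is at most that on [[s, B + 1]], an interval of length at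
    least 1. *)
Lemma gen_lipschitz (B s v : R) : 1 <= s -> s <= v <= B ->
  gen v <= gen s + gen (B + 1) * (v - s).
Proof.
move=> s1 /andP[sv vB].
have := @gen_convex s v (B + 1) s1; rewrite sv => /(_ _) h.
have {}h := h (ltac:(lra)).
have := gen_ge1 s1; have : gen s <= gen (B + 1) by apply: gen_le; lra.
have : 1 <= B + 1 - s by lra.
have : gen s <= gen v by apply: gen_le; rewrite s1.
nra.
Qed.

Lemma gen_IVT (B c : R) : 1 <= B -> 1 <= c <= gen B ->
  exists2 s, 1 <= s <= B & gen s = c.
Proof.
(* Clamping to [[1, B]] makes the function Lipschitz on the whole line. *)
move=> B1 cB; pose cl (x : R) := Num.min (Num.max x 1) B.
have cl1 x : 1 <= cl x <= B by rewrite le_min le_max lexx orbT B1 ge_min lexx orbT.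
have clE x : 1 <= x <= B -> cl x = x.
  by move=> /andP[x1 xB]; rewrite /cl (max_l x1) (min_l xB).
have clD x y : x <= y -> cl x <= cl y /\ cl y - cl x <= y - x.
  move=> xy; rewrite /cl; case: (leP x 1) => ?; case: (leP y 1) => ?;
    case: (leP 1 B) => ?; case: (leP x B) => ?; case: (leP y B) => ?; split; lra.
set L := gen (B + 1).
have L0 : 1 <= L by apply: gen_ge1; lra.
have lip x y : x <= y -> `|gen (cl y) - gen (cl x)| <= L * (y - x).
  move=> xy; have [c1 c2] := clD _ _ xy.
  have /andP[x1 xB] := cl1 x; have /andP[y1 yB] := cl1 y.
  have g : gen (cl x) <= gen (cl y) by apply: gen_le; rewrite x1.
  rewrite ger0_norm ?subr_ge0//.
  have := @gen_lipschitz B (cl x) (cl y) x1; rewrite c1 yB -/L => /(_ isT); nra.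
have cont : continuous (fun x => gen (cl x)).
  move=> x; apply/cvgrPdist_lt => e e0.
  have eL : 0 < e / L by rewrite divr_gt0//; lra.
  near=> y; have : `|x - y| < e / L by near: y; exact: cvgr_dist_lt.
  rewrite ltr_pdivlMr ?(lt_le_trans ltr01)// mulrC; apply: le_lt_trans.
  have [xy|/ltW yx] := leP x y.
    by rewrite distrC (distrC x) (ger0_norm (_ : 0 <= y - x)) ?subr_ge0//; exact: lip.
  by rewrite (ger0_norm (_ : 0 <= x - y)) ?subr_ge0//; exact: lip.
have := @IVT R (fun x => gen (cl x)) 1 B c B1 (continuous_subspaceT cont).
rewrite /= !clE ?lexx ?B1// gen1 min_l ?max_r ?gen_ge1//.
move=> /(_ cB)[s]; rewrite in_itv/= => sB; rewrite clE// => sc.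
by exists s.
Unshelve. all: by end_near.
Qed.

Hypothesis a0 : a 0 < 1.

Let a_ge0 y : 0 <= a y. Proof. by case: a_pmf. Qed.

(** Positive and negative parts have equal means, so if one side carried no mass, neither would the
    other; all mass would sit at 0, against [a 0 < 1]. *)
Lemma jump_signs : (exists2 y, 0 < y & 0 < a y) /\ (exists2 y, y < 0 & 0 < a y).
Proof.
have [hp hn /eqP] := dexpect_EFin a_pmf a_mean.
rewrite subr_eq0 => /eqP e.
have zero (f : int -> R) : (forall y, 0 < f y -> a y = 0) -> mean a (fun y => Num.max (f y) 0) = 0.
  move=> h; rewrite -[RHS](mean_cst a_pmf (lexx 0)); apply: eq_mean_supp => y ay.
  by rewrite max_r// leNgt; apply: contra_neqN ay; exact: h.
have zero' (f : int -> R) : has_mean a (fun y => Num.max (f y) 0) ->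
    mean a (fun y => Num.max (f y) 0) = 0 -> forall y, 0 < f y -> a y = 0.
  move=> h h0 y fy; apply/eqP; rewrite eq_le a_ge0 andbT.
  have := mean_point a_pmf y h; rewrite h0 (max_l (ltW fy)).
  by rewrite pmulr_rle0.
have nz : ~ (forall y, y != 0 -> a y = 0).
  move=> h; move: a0; rewrite -(mean_indic a_pmf 0) -[ltRHS](mean1 a_pmf).
  suff -> : mean a (fun j => (j == 0)%:R) = mean a (fun=> 1) by rewrite ltxx.
  by apply: eq_mean_supp => y ay; case: eqVneq => // y0; rewrite (h _ y0) eqxx in ay.
have P0 (y : int) : (0 < y%:~R :> R) = (0 < y) by rewrite ltr0z.
have N0 (y : int) : (0 < - y%:~R :> R) = (y < 0) by rewrite oppr_gt0 ltrz0.
split; apply: contrapT => no; apply: nz => y; rewrite neq_lt => /orP[].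
- rewrite -N0; apply: (zero' (fun y => - y%:~R)) => //; rewrite -e; apply: (zero (fun y => y%:~R)) => z; rewrite P0 => z0.
  by apply: contrapT => /eqP az; apply: no; exists z => //; rewrite lt0r az a_ge0.
- move=> y0; apply: contrapT => /eqP ay; apply: no; exists y => //.
  by rewrite lt0r ay a_ge0.
- move=> y0; apply: contrapT => /eqP ay; apply: no; exists y => //.
  by rewrite lt0r ay a_ge0.
- rewrite -P0; apply: (zero' (fun y => y%:~R)) => //; rewrite e; apply: (zero (fun y => - y%:~R)) => z; rewrite N0 => z0.
  by apply: contrapT => /eqP az; apply: no; exists z => //; rewrite lt0r az a_ge0.
Qed.

Lemma gen_unbounded (c : R) : 1 <= c -> exists2 B, 1 <= B & c <= gen B.
Proof.
move=> c1; have [[y y0 ay] _] := jump_signs.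
have ca : 0 < c / a y by rewrite divr_gt0//; lra.
exists (1 + c / a y); first by lra.
have B1 : 1 <= 1 + c / a y by lra.
apply: le_trans (mean_point a_pmf y (gen_fin B1)).
rewrite -ler_pdivrMr//; apply: (@le_trans _ _ (1 + c / a y)); first by lra.
by case: y y0 {ay ca} B1 => // -[//|n] _ B1; rewrite -exprnP ler_eXnr.
Qed.

(** The intermediate value theorem provides a solution, so [xget] does not return its default. *)
Lemma rho_gen (c : R) : 1 < c -> 1 < rho a c /\ gen (rho a c) = c.
Proof.
move=> c1; have [B B1 cB] := gen_unbounded (ltW c1).
have [s /andP[s1 sB] sc] : exists2 s, 1 <= s <= B & gen s = c.
  by apply: gen_IVT => //; rewrite cB ltW.
have KE (u : R) : 1 <= u -> K a u = (gen u)%:E.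
  by move=> u1; rewrite -meanE; [apply: dexpect_ge0 => y; rewrite exprz_ge0//; lra| |exact: gen_fin].
have : [set s : R | 1 < s /\ K a s = c%:E] (rho a c).
  rewrite /rho; apply: xgetPex; exists s; split; last by rewrite KE// sc.
  by rewrite lt_neqAle s1 andbT; apply: contraTneq c1 => s1'; rewrite -sc -s1' gen1 ltxx.
by move=> [r1]; rewrite KE ?ltW// => -[].
Qed.

Lemma gen_lt (r t : R) : 1 < t < r -> 1 < gen r -> gen t < gen r.
Proof.
move=> /andP[t1 tr] g1; have := @gen_convex 1 t r (lexx 1).
rewrite (ltW t1) (ltW tr) gen1 => /(_ isT); nra.
Qed.

Lemma gen_gt (r s : R) : 1 < r < s -> 1 < gen r -> gen r < gen s.
Proof.
move=> /andP[r1 rs] g1; have := @gen_convex 1 r s (lexx 1).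
rewrite (ltW r1) (ltW rs) gen1 => /(_ isT); nra.
Qed.

(** For large [s] the top jump dominates and [gen s] behaves like [s ^+ k * a k], so the point is
    that [m * a k < r ^- k]. *)
Lemma gen_finite_range (k : nat) (m r : R) : finite_right_range a k -> 0 < m ->
  1 < r -> m * gen r = 1 ->
  exists2 s, r < s & m * gen s < (s / r) ^+ k.
Proof.
move=> [k0 ak ak0] m0 r1 mr; have r0 : 0 < r by lra.
have [_ [y y0 ay]] := jump_signs.
(* Strictness comes from a negative jump [y], whose term in [m * gen r = 1] is positive. *)
have mak : m * a k%:Z < r ^- k.
  rewrite -[ltRHS]div1r ltr_pdivlMr ?exprn_gt0// -mr -mulrA ltr_pM2l// mulrC.
  rewrite (mean_splitP a_pmf (pred1 k%:Z) (gen_fin (ltW r1))).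
  apply: (@lt_le_trans _ _ (r ^+ k * a k%:Z + r ^ y * a y)).
    by rewrite ltrDl mulr_gt0// exprz_gt0.
  have sub (D : pred int) : has_mean a (fun i => if D i then r ^ i else 0).
    apply: (has_mean_le a_pmf (gen_fin (ltW r1))) => i.
    by have : 0 <= r ^ i by [rewrite exprz_ge0// ltW]; case: (D i) => -> //; rewrite lexx.
  apply: lerD.
    by have := mean_point a_pmf k%:Z (sub (pred1 k%:Z)); rewrite /= eqxx.
  have := mean_point a_pmf y (sub (predC (pred1 k%:Z))).
  rewrite /= (_ : y == k%:Z = false); last by apply/eqP; lia.
  move=> /le_trans; apply; rewrite le_eqVlt; apply/orP; left; apply/eqP.
  by congr mean; apply/funext => i /=; case: eqP.
pose dl := r ^- k - m * a k%:Z.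
have dl0 : 0 < dl by rewrite subr_gt0.
have rs : r < r + m / dl by rewrite ltrDl divr_gt0.
(* With this choice [m < dl * s], so the gap [dl] outweighs the jumps below [k], whose contribution
   to [gen s] is at most [s ^+ k.-1]. *)
exists (r + m / dl) => //; set s := r + m / dl in rs *.
have s1 : 1 < s by lra. have s0 : 0 < s by lra.
have gs : gen s <= s ^+ k * a k%:Z + s ^+ k.-1.
  have -> : gen s = mean a (fun i => if i <= k%:Z then s ^ i else 0).
    apply: eq_mean_supp => i ai; case: (leP i k%:Z) => // ki.
    by move: ai; rewrite ak0 ?eqxx.
  have hk : has_mean a (fun i => (i == k%:Z)%:R : R).
    by apply: (@has_mean_bounded _ _ a a_pmf _ 1) => i; case: eqP => _; rewrite ?lexx ?ler01.
  have sk j : 0 <= s ^+ j by rewrite exprn_ge0// ltW.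
  rewrite -[X in _ * X](mean_indic a_pmf k%:Z) -[X in _ + X](mean_cst a_pmf (sk _)).
  have hc : has_mean a (fun=> s ^+ k.-1).
    by apply: (@has_mean_bounded _ _ a a_pmf _ (s ^+ k.-1)) => i; rewrite sk lexx.
  rewrite -meanZ// -meanD//; last exact: has_meanZ.
  apply: mean_le => //; first by apply: has_meanD => //; exact: has_meanZ.
  move=> i; case: (leP i k%:Z) => [ik|ik]; last by rewrite lexx addr_ge0// mulr_ge0.
  rewrite (exprz_ge0 _ (ltW s0))/=; case: eqVneq ik => [->|ik' ik].
    by rewrite mulr1 lerDl.
  rewrite mulr0 add0r exprnP ler_eXz2l//; lia.
rewrite expr_div_n; apply: (@le_lt_trans _ _ (m * (s ^+ k * a k%:Z + s ^+ k.-1))).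
  by rewrite ler_pM2l.
have -> : m * (s ^+ k * a k%:Z + s ^+ k.-1) = s ^+ k.-1 * (s * (m * a k%:Z) + m).
  by rewrite -[in s ^+ k](prednK k0) exprS; ring.
rewrite -[in s ^+ k / _](prednK k0) exprSr -mulrA ltr_pM2l ?exprn_gt0//.
rewrite prednK//.
have : m < dl * s by rewrite /s mulrDr mulrCA divff ?gt_eqF// mulr1 ltrDr mulr_gt0.
by rewrite /dl; lra.
Qed.

End generating_function.

(** * The tilted tail of the overall maximum *)

Lemma ex_lower_bound (R : realFieldType) (f : nat -> R) (k : nat) :
  (forall i, (0 < i <= k)%N -> 0 < f i) ->
  exists2 dl, 0 < dl <= 1 & forall i, (0 < i <= k)%N -> dl <= f i.
Proof.
elim: k => [|k IH] f0; first by exists 1; rewrite ?ltr01 ?lexx// => -[|i].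
have [i ik|dl /andP[dl0 dl1] dlf] := IH.
  by apply: f0; case/andP: ik => -> /leqW.
exists (Num.min dl (f k.+1)).
  by rewrite lt_min dl0 f0 ?ltnSn//= ge_min dl1.
move=> i /andP[i0]; rewrite leq_eqVlt => /orP[/eqP ->|ik].
  by rewrite ge_min lexx orbT.
by rewrite ge_min dlf// i0.
Qed.

Section limit.
Context {R : realType} (a : int -> R) (p : nat -> R) (m r : R).
Hypotheses (a_pmf : is_pmf a) (p_pmf : is_pmf p).
Hypotheses (p_mean : has_mean p (fun k => k%:R)) (p_meanE : mean p (fun k => k%:R) = m).
Hypothesis m_gt0 : 0 < m.
Local Notation gen s := (mean a (fun y => s ^ y)).
Hypothesis gen_fin : forall s : R, 1 <= s -> has_mean a (fun y => s ^ y).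
Hypotheses (r_gt1 : 1 < r) (gen_r : m * gen r = 1).

Local Notation reach := (reach a p).
Local Notation hit := (hit p).

(** The tail [P (M >= x)] of the overall maximum, as [prob_maxpos] shows. *)
Definition reach_lim (x : int) : R := limn (fun n => reach n x).

Let r_gt0 : 0 < r. Proof. exact: lt_trans r_gt1. Qed.

Let rz_gt0 (z : int) : 0 < r ^ z. Proof. by rewrite exprz_gt0. Qed.

Let rz_ge0 (z : int) : 0 <= r ^ z. Proof. exact: ltW (rz_gt0 z). Qed.

Let m_ge0 : 0 <= m. Proof. exact: ltW. Qed.

Lemma is_cvg_reach x : cvgn (fun n => reach n x).
Proof.
apply: nondecreasing_is_cvgn; first exact: reach_nondecreasing.
by exists 1 => _ [n _ <-]; case/andP: (reach01 a_pmf p_pmf n x).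
Qed.

Lemma reach_le_lim n x : reach n x <= reach_lim x.
Proof.
apply: (nondecreasing_cvgn_le (reach_nondecreasing a_pmf p_pmf x)).
exact: is_cvg_reach.
Qed.

Lemma reach_lim_le x (c : R) : (forall n, reach n x <= c) -> reach_lim x <= c.
Proof.
move=> h; apply: limr_le; first exact: is_cvg_reach.
by apply: nearW.
Qed.

Lemma reach_lim01 x : 0 <= reach_lim x <= 1.
Proof.
have /andP[h _] := reach01 a_pmf p_pmf 0 x.
rewrite (le_trans h (reach_le_lim 0 x))/=.
by apply: reach_lim_le => n; case/andP: (reach01 a_pmf p_pmf n x).
Qed.

Lemma reach_lim_sub x : 0 < x -> reach_lim x <= mean a (fun y => hit (reach_lim (x - y))).
Proof.
move=> x0; apply: reach_lim_le => -[|n].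
  rewrite reach0//; apply: mean_ge0 => //.
  exact: (has_mean_hit a_pmf p_pmf x reach_lim01).
rewrite reachS//; apply: mean_le => //.
  exact: (has_mean_hit a_pmf p_pmf x reach_lim01).
move=> y; have /andP[-> _] /= := hit01 p_pmf (reach01 a_pmf p_pmf n (x - y)).
have /andP[r0 _] := reach01 a_pmf p_pmf n (x - y); have /andP[_ l1] := reach_lim01 (x - y).
by apply: le_hit => //; rewrite r0 reach_le_lim.
Qed.

Lemma reach_le_r n x : reach n x <= r ^ (- x).
Proof.
rewrite -[leRHS]mul1r -(expr1n _ n); apply: (reach_le (m := m)) => //.
- exact: ltW.
- by rewrite gen_r.
Qed.

(** The limit is itself a subsolution, and it lies below [r ^ (- x)], hence below [t ^ (- x)] for
    [x > 0]. *)
Lemma reach_lim_compare (t : R) : 1 <= t <= r ->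
  forall n x, 0 <= x -> reach_lim x <= reach n x + (m * gen t) ^+ n * t ^ (- x).
Proof.
move=> /andP[t1 tr] n x x0; apply: reach_compare => //.
- exact: reach_lim01.
- exact: reach_lim_sub.
move=> y y0; apply: reach_lim_le => k; apply: le_trans (reach_le_r k y) _.
by apply: le_exprzN; [rewrite t1|exact: ltW].
Qed.

Definition tilted (x : int) : R := r ^ x * reach_lim x.

Lemma tilted_ge0 x : 0 <= tilted x.
Proof. by rewrite mulr_ge0 ?rz_ge0//; case/andP: (reach_lim01 x). Qed.

Lemma tilted_le1 x : tilted x <= 1.
Proof.
rewrite /tilted mulrC -ler_pdivlMr// div1r invr_expz.
by apply: reach_lim_le => n; exact: reach_le_r.
Qed.

Let has_mean_tilted (c : R) : 0 <= c -> has_mean a (fun y => m * r ^ y * c).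
Proof.
move=> c0; rewrite (_ : (fun y => _) = fun y => m * c * r ^ y).
  by apply: has_meanZ; rewrite ?mulr_ge0 ?m_ge0//; apply: gen_fin; exact: ltW.
by apply/funext => y; rewrite mulrAC.
Qed.

(** The weights [m * r ^ y * a y] form a probability law, that of the tilted jumps. *)
Let mean_tilted (c : R) : 0 <= c -> mean a (fun y => m * r ^ y * c) = c.
Proof.
move=> c0; rewrite (_ : (fun y => _) = fun y => m * c * r ^ y); last first.
  by apply/funext => y; rewrite mulrAC.
rewrite meanZ//; [|by rewrite mulr_ge0 ?m_ge0|by apply: gen_fin; exact: ltW].
by rewrite mulrAC gen_r mul1r.
Qed.

Context (k : nat).
Hypotheses (a_range : finite_right_range a k) (nrc : nearly_right_continuous a k).

Let k_gt0 : (0 < k)%N. Proof. by case: a_range. Qed.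

Let supp_le y : a y != 0 -> y <= k%:Z.
Proof. by case: a_range => _ _ h; apply: contraNle => ky; rewrite h. Qed.

(* Maximum principle: under the tilted jump law the walk [x - S_n] cannot jump
   over [k] consecutive sites on its way down. *)
Lemma tilted_max (b : int) (M : R) : 0 <= b ->
  (forall x, b - k%:Z < x <= b -> tilted x <= M) ->
  forall x, b < x -> tilted x <= M.
Proof.
move=> b0 hM; have M0 : 0 <= M.
  by apply: le_trans (tilted_ge0 b) (hM b _); lia.
(* The bound is proved for each finite generation, where the recursion permits induction, and then
   passes to the limit. *)
suff h n x : b < x -> r ^ x * reach n x <= M.
  move=> x bx; rewrite /tilted mulrC -ler_pdivlMr//; apply: reach_lim_le => n.
  by rewrite ler_pdivlMr// mulrC h.
elim: n x => [|n IH] x bx; first by rewrite reach0 ?mulr0//; lia.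
have hr : has_mean a (fun y => hit (reach n (x - y))).
  exact: (has_mean_hit a_pmf p_pmf x (reach01 a_pmf p_pmf n)).
rewrite reachS; [|by []|by []|lia]; rewrite -meanZ ?rz_ge0// -[leRHS]mean_tilted//.
apply: mean_le_supp => //; first exact: has_mean_tilted.
move=> y /supp_le yk.
have h01 := reach01 a_pmf p_pmf n (x - y).
rewrite mulr_ge0 ?rz_ge0//=; last by case/andP: (hit01 p_pmf h01).
apply: (@le_trans _ _ (m * r ^ y * (r ^ (x - y) * reach n (x - y)))).
  have := hit_le_lin p_pmf p_mean p_meanE h01.
  move=> /(ler_wpM2l (rz_ge0 x)).
  have -> : r ^ x = r ^ y * r ^ (x - y) by rewrite -expfzDr ?gt_eqF// subrKC.
  by move=> /le_trans; apply; rewrite le_eqVlt; apply/orP; left; apply/eqP; ring.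
rewrite ler_wpM2l ?mulr_ge0 ?m_ge0 ?rz_ge0//.
have [bxy|xyb] := ltP b (x - y); first exact: IH.
apply: (@le_trans _ _ (tilted (x - y))); last by apply: hM; lia.
by rewrite /tilted ler_wpM2l ?reach_le_lim ?rz_ge0.
Qed.

(** One tilted jump from [b + 1] lands at values at most [M]; the jump [i] has weight
    [m * r ^ i * a i] and saves the deficit at its landing site. *)
Lemma tilted_contract (b : int) (M : R) : 0 <= b ->
  (forall x, b - k%:Z < x <= b -> tilted x <= M) ->
  forall i : nat, (0 < i <= k)%N ->
  tilted (b + 1) <= M - m * r ^ i * a i%:Z * (M - tilted (b + 1 - i%:Z)).
Proof.
move=> b0 hM i ik; have M0 : 0 <= M.
  by apply: le_trans (tilted_ge0 b) (hM b _); lia.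
set d := M - tilted _; have d0 : 0 <= d by rewrite subr_ge0 hM//; lia.
have c0 : 0 <= m * r ^ i * d by rewrite !mulr_ge0 ?m_ge0 ?rz_ge0.
have hi : has_mean a (fun y => (y == i%:Z)%:R : R).
  by apply: (@has_mean_bounded _ _ a a_pmf _ 1) => y; case: eqP => _; rewrite ?lexx ?ler01.
have hc := has_meanZ a_pmf c0 hi.
have hr : has_mean a (fun y => hit (reach_lim (b + 1 - y))).
  exact: (has_mean_hit a_pmf p_pmf (b + 1) reach_lim01).
have hr' := has_meanZ a_pmf (ltW (rz_gt0 (b + 1))) hr.
rewrite lerBrDr mulrAC -{1}(mean_indic a_pmf i%:Z) -meanZ//.
rewrite /tilted; apply: (@le_trans _ _ (r ^ (b + 1) * mean a (fun y => hit (reach_lim (b + 1 - y))) +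
    mean a (fun y => m * r ^ i * d * (y == i%:Z)%:R))).
  by rewrite lerD2r ler_pM2l// reach_lim_sub//; lia.
rewrite -meanZ ?rz_ge0// -meanD// -[leRHS]mean_tilted//.
apply: mean_le_supp => //; first exact: has_mean_tilted.
move=> y /supp_le yk.
have h01 := reach_lim01 (b + 1 - y).
have rh : 0 <= r ^ (b + 1) * hit (reach_lim (b + 1 - y)).
  by rewrite mulr_ge0 ?rz_ge0//; case/andP: (hit01 p_pmf h01).
rewrite addr_ge0//=; last by rewrite mulr_ge0.
have h1 : r ^ (b + 1) * hit (reach_lim (b + 1 - y)) <= m * r ^ y * tilted (b + 1 - y).
  have := hit_le_lin p_pmf p_mean p_meanE h01.
  move=> /(ler_wpM2l (ltW (rz_gt0 (b + 1)))) /le_trans; apply.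
  have -> : r ^ (b + 1) = r ^ y * r ^ (b + 1 - y) by rewrite -expfzDr ?gt_eqF// subrKC.
  by rewrite /tilted le_eqVlt; apply/orP; left; apply/eqP; ring.
(* Positive jumps land in the block of [k] sites ending at [b], the others above [b], where
   [tilted_max] applies. *)
have h2 : tilted (b + 1 - y) <= M.
  have [bxy|xyb] := ltP b (b + 1 - y); first exact: (tilted_max b0 hM).
  by apply: hM; clear -xyb yk; lia.
have mr : 0 <= m * r ^ y by rewrite mulr_ge0 ?m_ge0 ?rz_ge0.
apply: (le_trans (lerD h1 (lexx _))); case: eqVneq => [->|_].
  by rewrite mulr1 /d -mulrDr subrKC.
by rewrite mulr0 addr0 ler_wpM2l.
Qed.

(** The candidate [kappa] is the limsup, the infimum of the tail suprema. A value below [kappa - e]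
    far out would depress the next [k] values, and by [tilted_max] all later ones, below [kappa] by
    a fixed amount. *)
Lemma tilted_cvg : exists2 kappa : R, tilted n%:Z @[n --> \oo] --> kappa &
  forall c : R, (forall n : nat, c <= tilted n%:Z) -> c <= kappa.
Proof.
pose S (n : nat) : R := sup [set tilted i%:Z | i in [set i | (n <= i)%N]].
have hS n : has_sup [set tilted i%:Z | i in [set i | (n <= i)%N]].
  split; first by exists (tilted n%:Z); exists n => //=.
  by exists 1 => _ [i _ <-]; exact: tilted_le1.
have leS n i : (n <= i)%N -> tilted i%:Z <= S n.
  by move=> ni; apply: ub_le_sup; [case: (hS n)|exists i].
have Sle n (c : R) : (forall i, (n <= i)%N -> tilted i%:Z <= c) -> S n <= c.
  by move=> h; apply: ge_sup; [case: (hS n)|move=> _ [i ni <-]; exact: h].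
pose kappa := inf (range S).
have hI : has_inf (range S).
  split; first by exists (S 0%N); exists 0%N.
  by exists 0 => _ [n _ <-]; apply: le_trans (tilted_ge0 n%:Z) (leS n n (leqnn n)).
have kS n : kappa <= S n by apply: ge_inf; [case: hI|exists n].
have Sk (e : R) : 0 < e -> exists n, S n < kappa + e.
  by move=> e0; have [_ [n _ <-] h] := inf_adherent e0 hI; exists n.
exists kappa; last first.
  move=> c h; apply: lb_le_inf; first by case: hI.
  by move=> _ [n _ <-]; apply: le_trans (h n) (leS n n (leqnn n)).
have [i /nrc ai|dl /andP[dl0 dl1] dlE] := @ex_lower_bound R (fun i => m * r ^ i * a i%:Z) k.
  by rewrite !mulr_gt0.
have low (e : R) : 0 < e -> exists n0, forall j, (n0 <= j)%N -> kappa - e < tilted j%:Z.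
  move=> e0; have e'0 : 0 < dl * e / 2 by rewrite divr_gt0// mulr_gt0.
  have [b0 Sb0] := Sk _ e'0; exists (b0 + k)%N => j bj.
  rewrite ltNge; apply/negP => tj.
  (* Apply [tilted_contract] at [b = j + i - 1], so that the jump [i] lands on [j]. The deficit at
     [j] saves at least [dl * e], of which [M] gives back only half. *)
  have block (i : nat) : (0 < i <= k)%N -> tilted (j + i)%N%:Z <= kappa - dl * e / 2.
    move=> ik; set M := kappa + dl * e / 2.
    have hb (x : int) : (j + i)%N%:Z - 1 - k%:Z < x <= (j + i)%N%:Z - 1 -> tilted x <= M.
      move=> xb; have x0 : x = `|x|%N%:Z by clear -xb ik bj; lia.
      by rewrite x0; apply: le_trans (leS b0 _ _) (ltW Sb0); clear -xb ik bj; lia.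
    have jb : 0 <= (j + i)%N%:Z - 1 by clear -ik; lia.
    have := tilted_contract jb hb ik; rewrite subrK.
    rewrite (_ : (j + i)%N%:Z - i%:Z = j%:Z); last by clear; lia.
    have := dlE i ik; move: (m * r ^ i * a i%:Z) => q dq.
    have qM : 0 <= M - tilted j%:Z by rewrite /M; lra.
    have := ler_wpM2r qM dq; rewrite /M; nra.
  suff : S (j + k).+1 <= kappa - dl * e / 2 by have := kS (j + k).+1; lra.
  apply: Sle => i ji; apply: (@tilted_max (j + k)%N%:Z); [by []| |by []].
  move=> x xb; rewrite (_ : x = (j + (`|x| - j))%N%:Z); last by clear -xb; lia.
  by apply: block; clear -xb; lia.
apply/cvgrPdist_lt => e e0.
have [n0 h0] := low e e0; have [n1 h1] := Sk e e0.
near=> n; rewrite ltr_norml.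
have : kappa - e < tilted n%:Z by apply: h0; near: n; exact: nbhs_infty_ge.
have : tilted n%:Z < kappa + e.
  apply: le_lt_trans h1; apply: leS; near: n; exact: nbhs_infty_ge.
lra.
Unshelve. all: by end_near.
Qed.

End limit.

(** * Real levels and the maximum over all generations *)

Section maxpos.
Context {d : measure_display} {T : measurableType d} {R : realType}.
Context (P : probability T R) (xi : label -> T -> int) (N : label -> T -> nat).
Context (a : int -> R) (p : nat -> R).
Hypotheses (a_pmf : is_pmf a) (p_pmf : is_pmf p) (brw : is_brw P xi N a p).

Lemma maxpos_upto_int n (x : int) w :
  (maxpos_upto xi N n w < (x%:~R : R)%:E)%E ->
  (maxpos_upto xi N n w <= ((x - 1)%:~R : R)%:E)%E.
Proof.
move=> Mx; apply: ge_ereal_sup => _ [u [tu su] <-].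
rewrite lee_fin ler_int lerBrDr lezD1 -(ltr_int R) -lte_fin.
by apply: le_lt_trans Mx; apply: ereal_sup_ubound; exists u.
Qed.

Lemma maxpos_upto_ceil n (x : R) w :
  (x%:E <= maxpos_upto xi N n w)%E =
  (((Num.ceil x)%:~R : R)%:E <= maxpos_upto xi N n w)%E.
Proof.
apply/idP/idP => [xM|]; last by apply: le_trans; rewrite lee_fin ceil_ge.
rewrite leNgt; apply/negP => /maxpos_upto_int/(le_trans xM).
by rewrite lee_fin leNgt ceilB1_lt.
Qed.

Lemma rescaled_tailE (r x : R) n : rescaled_tail P xi N r x n =
  (r `^ x * reach a p n (Num.ceil x))%:E.
Proof.
rewrite /rescaled_tail EFinM; congr (_ * _)%E.
rewrite -(prob_maxpos_upto a_pmf p_pmf brw); congr (P _).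
by apply/seteqP; split=> w /=; rewrite (maxpos_upto_ceil n x).
Qed.

(** Continuity from below: by integrality, the supremum of the [M_n] reaches [x] only if some [M_n]
    does. *)
Lemma prob_maxpos (x : int) :
  P [set w | ((x%:~R : R)%:E <= maxpos xi N w)%E] = (reach_lim a p x)%:E.
Proof.
pose F n := [set w | ((x%:~R : R)%:E <= maxpos_upto xi N n w)%E].
have mF n : measurable (F n) by exact: (measurable_maxpos_upto brw).
have -> : [set w | ((x%:~R : R)%:E <= maxpos xi N w)%E] = \bigcup_n F n.
  apply/seteqP; split=> [w xM|w [n _ xM]]; last first.
    by apply: le_trans xM _; apply: ereal_sup_ubound; exists n.
  apply: contrapT => no.
  have : (maxpos xi N w <= ((x - 1)%:~R : R)%:E)%E.
    apply: ge_ereal_sup => _ [n _ <-]; apply: maxpos_upto_int.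
    by rewrite ltNge; apply/negP => h; apply: no; exists n.
  by move=> /(le_trans xM); rewrite lee_fin ler_int; lia.
have nF : nondecreasing_seq F.
  move=> n n' nn; apply/subsetPset => w; rewrite /F /= => /le_trans; apply.
  apply: ereal_sup_le => _ [u [tu su] <-]; exists u => //; split=> //.
  exact: leq_trans nn.
have h := @nondecreasing_cvg_mu _ _ _ P F mF (bigcup_measurable (fun n _ => mF n)) nF.
apply: (cvg_unique _ h) => //.
rewrite (_ : P \o F = EFin \o (fun n => reach a p n x)); last first.
  by apply/funext => n /=; rewrite /F (prob_maxpos_upto a_pmf p_pmf brw).
by apply: cvg_EFin; [exact: nearW|exact: is_cvg_reach].
Qed.

End maxpos.

(** * Exponential rates along the level [c * n] *)

Section rates.
Context {R : realType}.
Implicit Types (r t u c : R).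

Lemma expr_powR_lt1 r t u c : 0 < r -> 0 < t -> 0 < u ->
  ln u + c * (ln r - ln t) < 0 -> 0 < u * (r `^ c / t `^ c) < 1.
Proof.
move=> r0 t0 u0 h; rewrite mulr_gt0 ?divr_gt0 ?powR_gt0//=.
rewrite /powR !gt_eqF// -expRN -expRD -{1}(@lnK _ u) ?posrE// -expRD.
rewrite -[ltRHS]expR0 ltr_expR; lra.
Qed.

Lemma powR_expr_le r t u c (n : nat) (x : int) : 0 < r -> 1 <= t -> 0 < u ->
  c * n%:R <= x%:~R ->
  r `^ (c * n%:R) * (u ^+ n * t ^ (- x)) <= (u * (r `^ c / t `^ c)) ^+ n.
Proof.
move=> r0 t1 u0 cx; have t0 : 0 < t by lra.
rewrite powRrM powR_mulrn ?powR_ge0// mulrCA exprMn ler_pM2l ?exprn_gt0//.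
rewrite expr_div_n ler_pM2l ?exprn_gt0 ?powR_gt0//.
rewrite -powR_mulrn ?powR_ge0// -powRrM -(powR_intmul _ (ltW t0)) mulrNz powRN.
by rewrite lef_pV2 ?posrE ?powR_gt0// ler_powR.
Qed.

Lemma cvg_expr0 (z : R) : 0 < z < 1 -> z ^+ n @[n --> \oo] --> 0.
Proof. by move=> /andP[z0 z1]; apply: cvg_expr; rewrite gtr0_norm. Qed.

Lemma limn_einf_ge (u : (\bar R)^nat) (l : \bar R) (n0 : nat) :
  (forall n, (n0 <= n)%N -> (l <= u n)%E) -> (l <= limn_einf u)%E.
Proof.
move=> h; rewrite limn_einf_lim; apply: lime_ge; first exact: is_cvg_einfs.
exists n0 => // n /= nn; apply: le_ereal_inf_tmp => _ [k /= nk <-].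
by apply: h; exact: leq_trans nk.
Qed.

Lemma limn_esup_le (u : (\bar R)^nat) (l : \bar R) :
  (forall n, (u n <= l)%E) -> (limn_esup u <= l)%E.
Proof.
move=> h; rewrite limn_esup_lim; apply: lime_le; first exact: is_cvg_esups.
by apply: nearW => n; apply: ge_ereal_sup => _ [k _ <-].
Qed.

End rates.

Theorem theorem1p6 (R : realType) (a : int -> R) (p : nat -> R) (m : R)
    (d : measure_display) (T : measurableType d) (P : probability T R)
    (xi : label -> T -> int) (N : label -> T -> nat)
    (a_pmf : is_pmf a) (p_pmf : is_pmf p)
    (p_mean : dexpect p (fun k => k%:R) = m%:E) (m01 : 0 < m < 1)
    (p_third_moment : (dexpect p (fun k => (k%:R ^+ 3)%R) < +oo)%E)
    (a_mean : dexpect a (fun y => y%:~R) = 0%E)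
    (a_variance : (dvariance a (fun y => y%:~R) < +oo)%E)
    (a0_lt1 : a 0 < 1)
    (K_finite : forall theta : R, 1 <= theta -> (K a theta < +oo)%E)
    (brw : is_brw P xi N a p) :
  let rho_m := rho a m^-1 in
  let g (c : R) (n : nat) := rescaled_tail P xi N rho_m (c * n%:R) n in
  exists dl du : R,
    [/\ 0 < dl <= du,
      (* (a) *)
      forall c : R, 0 < c < dl ->
        [/\ (0 < limn_einf (g c))%E, (limn_einf (g c) <= limn_esup (g c))%E
          & (limn_esup (g c) <= 1)%E],
      (* (b) M_n being integer-valued, the level cn is rounded to an integer,
         up or down *)
      forall r : nat, finite_right_range a r -> nearly_right_continuous a r ->
        exists kappa : R,
          [/\ 0 < kappa <= 1,
            ((rho_m ^+ n)%:E * P [set w | ((n%:R : R)%:E <= maxpos xi N w)%E])%E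
              @[n --> \oo] --> kappa%:E
          & forall c : R, 0 < c < dl ->
            forall k : nat -> int, (forall n, `|(k n)%:~R - c * n%:R| < 1) ->
              rescaled_tail P xi N rho_m (k n)%:~R n @[n --> \oo] --> kappa%:E],
      (* (c) *)
      forall c : R, du < c -> g c n @[n --> \oo] --> 0%E
    & forall r : nat, finite_right_range a r -> du < r%:R].
Proof.
move=> rho_m g.
have /andP[m_gt0 m_lt1] := m01.
have gen_fin (s : R) : 1 <= s -> has_mean a (fun y => s ^ y).
  by move=> s1; case: (K_mean a_pmf s1 (K_finite s s1)).
have [hp pE] : has_mean p (fun k => k%:R) /\ mean p (fun k => k%:R) = m.
  by apply: has_mean_fin => //; rewrite -dexpect_ge0.
have hp2 : has_mean p (fun k => k%:R ^+ 2).
  have h3 : has_mean p (fun k => k%:R ^+ 3).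
    by split=> [i|]; [rewrite exprn_ge0|rewrite -dexpect_ge0// => i; rewrite exprn_ge0].
  apply: (has_mean_le p_pmf h3) => k; rewrite exprn_ge0//= -!natrX ler_nat.
  by case: k => // k; rewrite leq_pexp2l.
have mV1 : 1 < m^-1 by rewrite invf_gt1.
have [] := rho_gen a_pmf gen_fin a_mean a0_lt1 mV1.
rewrite -/rho_m => r1 genrE; clearbody rho_m; rename rho_m into r.
have r0 : 0 < r by lra.
have gen_r : m * mean a (fun y => r ^ y) = 1 by rewrite genrE divff// gt_eqF.
have gen_r1 : 1 < mean a (fun y => r ^ y) by rewrite genrE.
pose gen (s : R) := mean a (fun y => s ^ y).
(* Any point strictly between 1 and [r] would serve: it gives [lam < 1], the decay rate of the
   comparison error. *)
pose t := (1 + r) / 2.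
have t1 : 1 < t by rewrite /t; lra.
have tr : t < r by rewrite /t; lra.
have t0 : 0 < t by lra.
have ttr : 1 <= t <= r by rewrite !ltW.
pose lam := m * gen t.
have lam0 : 0 < lam.
  by rewrite mulr_gt0// (lt_le_trans ltr01)// gen_ge1// ltW.
have lam1 : lam < 1.
  by rewrite -gen_r ltr_pM2l//; apply: (gen_lt a_pmf gen_fin) => //; rewrite t1.
have lrt : 0 < ln r - ln t by rewrite subr_gt0 ltr_ln ?posrE.
(* The right range is unique if it exists, so one [s] serves every [k]; without a finite range any
   [s > r] will do. *)
have [s rs sR] : exists2 s, r < s &
    forall k : nat, finite_right_range a k -> m * gen s < (s / r) ^+ k.
  have [[k ak]|no] := pselect (exists k, finite_right_range a k).
    have [s rs sk] := gen_finite_range a_pmf gen_fin a_mean a0_lt1 ak m_gt0 r1 gen_r.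
    exists s => // k' ak'; suff -> : k' = k by [].
    have [_ ck hk] := ak; have [_ ck' hk'] := ak'.
    apply/eqP; rewrite eqn_leq; apply/andP; split; rewrite leqNgt; apply/negP => kk.
      by move: ck'; rewrite hk ?ltxx// ltz_nat.
    by move: ck; rewrite hk' ?ltxx// ltz_nat.
  by exists (r + 1); [lra|move=> k ak; exfalso; apply: no; exists k].
have s1 : 1 < s by lra. have s0 : 0 < s by lra.
pose mu := m * gen s.
have mu1 : 1 < mu.
  by rewrite -gen_r ltr_pM2l//; apply: (gen_gt a_pmf gen_fin) => //; rewrite r1.
have mu0 : 0 < mu by lra.
have lsr : 0 < ln s - ln r by rewrite subr_gt0 ltr_ln ?posrE.
(* At [c = du] the rate [mu * (r / s) ^ c] equals 1, and beyond it decays. Likewise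
   [lam * (r / t) ^ c] is below 1 for [c < dl]; the minimum with [du] orders the thresholds. *)
pose du := ln mu / (ln s - ln r).
have du0 : 0 < du by rewrite divr_gt0// ln_gt0.
pose dl := Num.min du (- ln lam / (ln r - ln t)).
have dl0 : 0 < dl.
  by rewrite lt_min du0 divr_gt0// oppr_gt0 ln_lt0// lam0.
have zlt c : 0 < c < dl -> 0 < lam * (r `^ c / t `^ c) < 1.
  move=> /andP[_]; rewrite lt_min => /andP[_]; rewrite ltr_pdivlMr// => h.
  by apply: expr_powR_lt1 => //; lra.
have gE c n : g c n = (r `^ (c * n%:R) * reach a p n (Num.ceil (c * n%:R)))%:E.
  exact: (rescaled_tailE a_pmf p_pmf brw).
have reach_r n x : reach a p n x <= r ^ (- x).
  exact: (reach_le_r a_pmf p_pmf hp pE m_gt0 gen_fin r1 gen_r).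
have [e e0 he] : exists2 e : R, 0 < e & forall n x, 0 <= x ->
    e * r ^ (- x) <= reach a p n x + lam ^+ n * t ^ (- x).
  have r2 : 1 < m * gen (r ^+ 2).
    rewrite -gen_r ltr_pM2l//; apply: (gen_gt a_pmf gen_fin) => //.
    by rewrite r1 expr2 ltr_pMl.
  have [e e0 he] := reach_ge a_pmf p_pmf hp pE hp2 m_gt0 gen_fin r1 gen_r r2.
  by exists e => // n x; apply: he.
exists dl, du; split.
- by rewrite dl0 ge_min lexx.
- move=> c cdl; have /andP[c0 _] := cdl.
  have ceil0 n : 0 <= Num.ceil (c * n%:R).
    by rewrite ceil_ge0 (lt_le_trans (ltrN10 R))// mulr_ge0// ltW.
  split; last 2 first.
  + exact: limn_einf_sup.
  + apply: limn_esup_le => n; rewrite gE lee_fin.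
    apply: (@le_trans _ _ (r `^ (c * n%:R) * r ^ (- Num.ceil (c * n%:R)))).
      by rewrite ler_pM2l ?powR_gt0.
    rewrite -(powR_intmul _ (ltW r0)) mulrNz powRN ler_pdivrMr ?powR_gt0// mul1r.
    by rewrite ler_powR ?ceil_ge// ltW.
  (* Rounding the level up costs at most a factor [r], and half of the remaining [e / r] is left to
     the vanishing comparison error. *)
  have er : 0 < e / r / 2 by rewrite !divr_gt0.
  have := cvg_expr0 (zlt c cdl) => /cvgrPdist_lt/(_ _ er)[n0 _ hn0].
  apply: (@lt_le_trans _ _ (e / r / 2)%:E); first by rewrite lte_fin.
  apply: (@limn_einf_ge _ _ _ n0) => n nn; rewrite gE lee_fin.
  have := hn0 n nn; rewrite /= sub0r normrN => /ltr_normlW zn.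
  set y := c * n%:R; set x := Num.ceil y.
  have h1 : r `^ y * (lam ^+ n * t ^ (- x)) <= (lam * (r `^ c / t `^ c)) ^+ n.
    by apply: powR_expr_le => //; [exact: ltW|exact: ceil_ge].
  have h2 : e / r <= r `^ y * (e * r ^ (- x)).
    rewrite mulrCA ler_pM2l// -(powR_intmul _ (ltW r0)) mulrNz powRN.
    rewrite ler_pdivlMr ?powR_gt0// mulrC -(powR_inv1 (ltW r0)) -powRD; last first.
      by rewrite (gt_eqF r0) implybT.
    apply: (ler_powR (ltW r1)).
    by have := ceilB1_lt y; rewrite -/x mulrzBr; lra.
  have := ler_wpM2l (powR_ge0 r y) (he n x (ceil0 n)); rewrite mulrDr; lra.
- move=> k ak nrc.
  have [kappa kc klow] := tilted_cvg a_pmf p_pmf hp pE m_gt0 gen_fin r1 gen_r ak nrc.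
  have tilt1 n : tilted a p r n <= 1.
    exact: (tilted_le1 a_pmf p_pmf hp pE m_gt0 gen_fin r1 gen_r).
  exists kappa; split.
  + apply/andP; split.
      (* Letting the number of generations grow in [he] turns it into [e <= tilted] at every level,
         which passes to [kappa]. *)
      apply: (lt_le_trans e0); apply: klow => n.
      rewrite /tilted mulrC -ler_pdivrMr ?exprz_gt0// invr_expz.
      have lim0 : (fun j => reach_lim a p n%:Z + lam ^+ j * t ^ (- n%:Z)) @ \oo
          --> reach_lim a p n%:Z + 0 * t ^ (- n%:Z).
        apply: cvgD; first exact: cvg_cst.
        by apply: cvgMl; apply: cvg_expr0; rewrite lam0.
      rewrite mul0r addr0 in lim0.
      rewrite -(cvg_lim _ lim0)//; apply: limr_ge; first exact: cvgP lim0.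
      apply: nearW => j; apply: le_trans (he j n%:Z _) _ => //.
      by rewrite lerD2r; exact: reach_le_lim.
    rewrite -(cvg_lim _ kc)//; apply: limr_le; first exact: cvgP kc.
    by apply: nearW => n; exact: tilt1.
  + rewrite (_ : (fun n => _) = EFin \o (fun n : nat => tilted a p r n%:Z)).
      by apply: cvg_EFin => //; exact: nearW.
    apply/funext => n /=; rewrite (_ : n%:R = n%:Z%:~R)//.
    by rewrite (prob_maxpos a_pmf p_pmf brw) -EFinM.
  move=> c cdl kk kkc; have /andP[c0 _] := cdl.
  have kk0 n : 0 <= kk n.
    have := kkc n; rewrite ltr_norml => /andP[h _].
    have : 0 <= c * n%:R by rewrite mulr_ge0// ltW.
    move=> cn; have : -1 < kk n by rewrite -(ltr_int R) mulrN1z; lra.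
    by case: (kk n).
  rewrite (_ : (fun n => _) = EFin \o (fun n => r ^ kk n * reach a p n (kk n))); last first.
    apply/funext => n /=; rewrite (rescaled_tailE a_pmf p_pmf brw) intrKceil.
    by rewrite powR_intmul// ltW.
  apply: cvg_EFin; first exact: nearW.
  have kk_oo : `|kk n|%N @[n --> \oo] --> \oo.
    apply/cvgnyPge => A; near=> n.
    have An : (A%:R + 1) / c <= n%:R by near: n; exact: nbhs_infty_ger.
    have := kkc n; rewrite ltr_norml => /andP[h _].
    rewrite ler_pdivrMr// mulrC in An.
    rewrite -lez_nat gez0_abs// -(ler_int R); apply: ltW.
    by rewrite -pmulrn; lra.
  have tc : tilted a p r (kk n) @[n --> \oo] --> kappa.
    have := cvg_comp _ _ kk_oo kc; apply: cvg_trans; apply: near_eq_cvg.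
    by apply: nearW => n /=; rewrite gez0_abs.
  pose z := lam * (r `^ c / t `^ c).
  (* The gap to [tilted] is at most [(r / t) * z ^+ n], the factor [r / t] covering a level of up to
     [c * n + 1]. *)
  apply: (squeeze_cvgr (f := fun n => tilted a p r (kk n) - r / t * z ^+ n)
      (h := fun n => tilted a p r (kk n))) => //; last first.
    rewrite -[X in _ --> X]subr0 -(mulr0 (r / t)); apply: cvgB => //.
    by apply: cvgMr; exact: cvg_expr0 (zlt c cdl).
  apply: nearW => n; apply/andP; split; last first.
    by rewrite /tilted ler_pM2l ?exprz_gt0//; exact: reach_le_lim.
  rewrite lerBlDr /tilted.
  have := reach_lim_compare a_pmf p_pmf hp pE m_gt0 gen_fin r1 gen_r ttr n (kk0 n).
  have rk : 0 <= r ^ kk n by rewrite exprz_ge0 ?ltW.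
  move=> /(ler_wpM2l rk) /le_trans; apply; rewrite mulrDr lerD2l.
  apply: (@le_trans _ _ (lam ^+ n * (r / t) `^ (c * n%:R + 1))).
    rewrite mulrCA ler_pM2l ?exprn_gt0// -exprz_inv -expfzMl.
    have rt : 1 <= r / t by rewrite ler_pdivlMr// mul1r ltW.
    have rt0 : 0 <= r / t by lra.
    rewrite -(powR_intmul (kk n) rt0).
    apply: ler_powR => //; have := kkc n; rewrite ltr_norml => /andP[_]; lra.
  have q0 : 0 < r / t by rewrite divr_gt0.
  have qc : (r / t) `^ c = r `^ c / t `^ c.
    rewrite powRM ?invr_ge0 ?(ltW r0) ?(ltW t0)// -(powR_inv1 (ltW t0)) powRAC.
    by rewrite powR_inv1 ?powR_ge0.
  rewrite powRD; last by rewrite (gt_eqF q0) implybT.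
  rewrite (powRr1 (ltW q0)) powRrM powR_mulrn ?powR_ge0// qc /z.
  by rewrite mulrA -exprMn mulrC.
- move=> c cdu; have c0 : 0 < c by exact: lt_trans cdu.
  have z01 : 0 < mu * (r `^ c / s `^ c) < 1.
    by apply: expr_powR_lt1 => //; move: cdu; rewrite ltr_pdivrMr//; lra.
  rewrite (_ : g c = EFin \o (fun n => r `^ (c * n%:R) * reach a p n (Num.ceil (c * n%:R)))); last first.
    by apply/funext => n; rewrite gE.
  apply: cvg_EFin; first exact: nearW.
  apply: (squeeze_cvgr (f := fun=> 0) (h := fun n => (mu * (r `^ c / s `^ c)) ^+ n)).
  + apply: nearW => n; have /andP[h0 _] := reach01 a_pmf p_pmf n (Num.ceil (c * n%:R)).
    rewrite mulr_ge0 ?powR_ge0//=.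
    apply: le_trans (powR_expr_le r0 (ltW s1) mu0 (ceil_ge (c * n%:R))).
    rewrite ler_pM2l ?powR_gt0//.
    by apply: (reach_le a_pmf p_pmf hp pE m_gt0 gen_fin); rewrite // ltW.
  + exact: cvg_cst.
  + exact: cvg_expr0.
(* Taking logarithms, [du < k] amounts to [mu < (s / r) ^+ k], which is how [s] was chosen. *)
- move=> k ak; rewrite ltr_pdivrMr// -(ln_div _ _) ?posrE//.
  by rewrite mulr_natl -lnXn ?divr_gt0// ltr_ln ?posrE ?exprn_gt0 ?divr_gt0// sR.
Unshelve. all: by end_near.
Qed.
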